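(* Suppose that $\gamma$ runs through conjugacy classes of primitive hyperbolic elements of $\mathrm{SL}_2(\mathbb{Z})$, and let $\Psi:\mathrm{SL}_2(\mathbb{Z})\to\mathbb{Z}$ be the Rademacher symbol. For any $m\in\mathbb{Z}_{>0}$ and $k\in\mathbb{Z}/m\mathbb{Z}$, $$\lim_{\nu\to\infty}\frac{\#\{\gamma\mid |\mathrm{tr}\,\gamma|<\nu,\ \Psi(\gamma)=k\text{ in }\mathbb{Z}/m\mathbb{Z}\}}{\#\{\gamma\mid|\mathrm{tr}\,\gamma|<\nu\}}=\frac1m.$$
   Context: An element $\gamma\in\mathrm{SL}_2(\mathbb{Z})$ is hyperbolic if $|\mathrm{tr}\,\gamma|>2$. Let $\mathbb{H}^2$ be the upper half plane and $\Delta(z)=q\prod_{n=1}^\infty(1-q^n)^{24}$ with $q=e^{2\pi\sqrt{-1}z}$, $z\in\mathbb{H}^2$. The Dedekind symbol $\Phi$ and the Rademacher symbol $\Psi$ are the functions $\mathrm{SL}_2(\mathbb{Z})\to\mathbb{Z}$ satisfying, for every $\gamma=\begin{pmatrix}a&b\\c&d\end{pmatrix}\in\mathrm{SL}_2(\mathbb{Z})$ acting by $\gamma z=\frac{az+b}{cz+d}$, $$\log\Delta(\gamma z)-\log\Delta(z)=\begin{cases}6\log(-(cz+d)^2)+2\pi i\,\Phi(\gamma)&\text{if }c\ne0,\\ 2\pi i\,\Phi(\gamma)&\text{if }c=0,\end{cases}$$ $$\Psi(\gamma)=\Phi(\gamma)-3\,\mathrm{sgn}(c(a+d)).$$ Here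 the branch of the logarithm is taken with $-\pi\le\mathrm{Im}\log z<\pi$, and $\log\Delta$ denotes the holomorphic function $2\pi i z+24\sum_{n\ge1}\log(1-q^n)$ on $\mathbb{H}^2$. The function $\Psi$ is constant on conjugacy classes (it factors through the conjugacy classes of $\mathrm{PSL}_2(\mathbb{Z})$), as is the trace. *)

(* Defs.v *)
From HB Require Import structures.
From mathcomp Require Import all_boot all_order all_algebra.
From mathcomp Require Import finmap complex.
From mathcomp Require Import all_classical all_reals all_analysis.

Set Implicit Arguments.
Unset Strict Implicit.
Unset Printing Implicit Defensive.

Import Order.TTheory GRing.Theory Num.Theory numFieldNormedType.Exports.

Local Open Scope classical_set_scope.
Local Open Scope ring_scope.
Local Open Scope complex_scope.

Record SL2Z := MkSL2Z { SL2Z_mx :> 'M[int]_2 ; _ : \det SL2Z_mx == 1 }.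

HB.instance Definition _ := [isSub for SL2Z_mx].
HB.instance Definition _ := [Choice of SL2Z by <:].

Lemma SL2Z_det (g : SL2Z) : \det g = 1.
Proof. exact/eqP/(valP g). Qed.

Lemma SL2Z_unit (g : SL2Z) : SL2Z_mx g \in unitmx.
Proof. by rewrite unitmxE SL2Z_det unitr1. Qed.

Lemma SL2Z_mul_subproof (g h : SL2Z) : \det (g *m h) == 1.
Proof. by rewrite det_mulmx !SL2Z_det mulr1. Qed.

Lemma SL2Z_one_subproof : \det (1%:M : 'M[int]_2) == 1.
Proof. by rewrite det1. Qed.

Lemma SL2Z_inv_subproof (g : SL2Z) : \det (invmx g) == 1.
Proof. by rewrite det_inv SL2Z_det invr1. Qed.

Definition SL2Z_mul g h := MkSL2Z (SL2Z_mul_subproof g h).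
Definition SL2Z_one := MkSL2Z SL2Z_one_subproof.
Definition SL2Z_inv g := MkSL2Z (SL2Z_inv_subproof g).

Lemma SL2Z_mulA : associative SL2Z_mul.
Proof. by move=> g h k; apply: val_inj; rewrite /= mulmxA. Qed.

Lemma SL2Z_mul1 : left_id SL2Z_one SL2Z_mul.
Proof. by move=> g; apply: val_inj; rewrite /= mul1mx. Qed.

Lemma SL2Z_mulr1 : right_id SL2Z_one SL2Z_mul.
Proof. by move=> g; apply: val_inj; rewrite /= mulmx1. Qed.

Lemma SL2Z_mulV : left_inverse SL2Z_one SL2Z_inv SL2Z_mul.
Proof. by move=> g; apply: val_inj; rewrite /= mulVmx ?SL2Z_unit. Qed.

Lemma SL2Z_mulrV : right_inverse SL2Z_one SL2Z_inv SL2Z_mul.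
Proof. by move=> g; apply: val_inj; rewrite /= mulmxV ?SL2Z_unit. Qed.

HB.instance Definition _ :=
  isGroup.Build SL2Z SL2Z_mulA SL2Z_mul1 SL2Z_mulr1 SL2Z_mulV SL2Z_mulrV.

Definition entry_a (g : SL2Z) : int := SL2Z_mx g 0 0.
Definition entry_b (g : SL2Z) : int := SL2Z_mx g 0 1.
Definition entry_c (g : SL2Z) : int := SL2Z_mx g 1 0.
Definition entry_d (g : SL2Z) : int := SL2Z_mx g 1 1.

Definition hyperbolic (g : SL2Z) : Prop := 2 < `|\tr g|.

(* Not a proper power in SL2(Z); since h^-n = (h^-1)^n, positive exponents
   suffice. *)
Definition primitive (g : SL2Z) : Prop :=
  forall (h : SL2Z) (n : nat), (1 < n)%N -> g <> (h ^+ n)%g.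

Definition conj_class (g : SL2Z) : set SL2Z := range (fun h : SL2Z => (g ^ h)%g).

(* Counts the conjugacy classes meeting P; 0 by convention if there are
   infinitely many. A quotient of two such counts vanishes if either is
   infinite (x / 0 = 0), so it cannot tend to a positive limit that way. *)
Definition num_classes (P : set SL2Z) : nat :=
  #|` fset_set (conj_class @` P) |.

Section DedekindSymbol.
Variable R : realType.
Local Notation C := R[i].

Definition cexp (z : C) : C :=
  (expR (complex.Re z))%:C *
  (cos (complex.Im z) +i* sin (complex.Im z)).

(* The branch with imaginary part in [-pi, pi[; the value at 0 is junk. *)
Definition clog (z : C) : C :=
  xget 0 [set w | cexp w = z /\ - pi <= complex.Im w < pi].

Definition two_pi_i : C := 0 +i* (2 * pi).

(* The holomorphic logarithm of Delta(z) = q * prod_(n >= 1) (1 - q ^ n) ^ 24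
   given by its series; the ascription selects the norm topology on R[i]. *)
Definition log_Delta (z : C) : C :=
  let q := cexp (two_pi_i * z) in
  two_pi_i * z + 24 *
    limn (series (fun n => clog (1 - q ^+ n.+1)) : nat -> (R[i] : numFieldType)).

Definition automorphy (g : SL2Z) (z : C) : C :=
  (entry_c g)%:~R * z + (entry_d g)%:~R.

Definition moebius (g : SL2Z) (z : C) : C :=
  ((entry_a g)%:~R * z + (entry_b g)%:~R) / automorphy g z.

Definition dedekind_symbol (Phi : SL2Z -> int) : Prop :=
  forall (g : SL2Z) (z : C), 0 < complex.Im z ->
    log_Delta (moebius g z) - log_Delta z =
    (if entry_c g != 0 then 6 * clog (- automorphy g z ^+ 2) else 0)
    + two_pi_i * (Phi g)%:~R.

(* Phi is uniquely determined by dedekind_symbol. *)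
Definition rademacher_symbol (Psi : SL2Z -> int) : Prop :=
  exists2 Phi : SL2Z -> int, dedekind_symbol Phi &
    forall g, Psi g = Phi g - 3 * sgz (entry_c g * (entry_a g + entry_d g)).

End DedekindSymbol.

(* Main.v *)
(** Up to sign, the hyperbolic conjugacy classes correspond to the even-length
    words [a1, ..., a2n] of positive integers, up to rotation by two letters:
    the word stands for R^a1 L^a2 ... R^a(2n-1) L^a(2n), where R and L are the
    upper and lower elementary matrices, and the Rademacher symbol is the
    alternating sum a1 - a2 + ... - a2n.  As a function of one letter a the
    trace is affine, a x + y, so the letters a >= K that may be substituted
    for a fixed large letter form an interval, over which the alternating sum
    is equidistributed modulo m up to a bounded error.  Marking a word at each
    of its large letters, with total weight 1, bounds the total error by O(1/K)
    times the number of classes of trace at most 2 nu, because each interval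
    contains [K, 2K) at the cost of doubling the trace.  It remains to see that
    doubling nu multiplies the count by a bounded factor (halve one letter, or
    delete two adjacent letters 1), and that words without large letters and
    proper powers are rare.  Neither the prime geodesic theorem nor any
    property of Delta beyond the cocycle relation implied by the definition of
    the Dedekind symbol is needed. *)
Require Import Defs.
From HB Require Import structures.
From mathcomp Require Import all_boot all_order all_algebra.
From mathcomp Require Import finmap complex.
From mathcomp Require Import all_classical all_reals all_analysis.
From mathcomp Require Import zify ring lra.

Set Implicit Arguments.
Unset Strict Implicit.
Unset Printing Implicit Defensive.

Import Order.TTheory GRing.Theory Num.Theory numFieldNormedType.Exports.

Local Open Scope classical_set_scope.
Local Open Scope ring_scope.

(** * Traces of continued fraction periods *)

(** The obstacle is that conjugacy allows only rotations by an even number of letters, while marking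
    and averaging over letters use all rotations. Rotation by one letter keeps the trace but negates
    the alternating sum, so the discrepancy is measured for the residues [k] and [- k] together; the
    same rotation shows that these two residues carry equal weight, which recovers [k] alone. Words
    are weighted by the inverse of their length, so that the rotations of a word have total weight 1
    when they are distinct. The parameters are chosen in a fixed order: the threshold [K] for large
    letters, then a length [n0], then the trace bound [V]. Passing from [V] to [K * V] costs a
    factor [1728 ^+ K]; words without large letters pay for it through [n0%:R^-1] if they are long,
    and are finite in number if they are short. The uniqueness of the word of a class is proved with
    integer matrices alone, without fixed points on the real line: R and L generate a free monoid,
    and a matrix intertwining two words is moved into this monoid up to sign. *)

Lemma mulmx22 (A B : 'M[int]_2) i j :
  (A *m B) i j = A i 0 * B 0 j + A i 1 * B 1 j.
Proof. by rewrite mxE big_ord_recl big_ord1; congr (_ + _ * _); congr (_ _ _); apply: val_inj. Qed.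

Lemma mxtrace22 (A : 'M[int]_2) : \tr A = A 0 0 + A 1 1.
Proof. by rewrite /mxtrace big_ord_recl big_ord1; congr (_ + _); congr (_ _ _); apply: val_inj. Qed.

Lemma det22 (A : 'M[int]_2) : \det A = A 0 0 * A 1 1 - A 0 1 * A 1 0.
Proof.
rewrite (expand_det_row _ 0) big_ord_recl big_ord1 /cofactor !det_mx11 !mxE /= expr0 expr1 mul1r mulN1r mulrN.
by congr (_ * A _ _ - A _ _ * A _ _); apply: val_inj.
Qed.

(* [block a *m block b] is R^a L^b, so for an even-length [s] the continuant
   matrix [cont s] is the word R^a1 L^a2 R^a3 ... of the header. *)
Definition block (a : nat) : 'M[int]_2 :=
  \matrix_(i, j) (if (i == 0) && (j == 0) then a%:Z else if (i == 1) && (j == 1) then 0 else 1).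

Definition cont (s : seq nat) : 'M[int]_2 := foldr (fun a => mulmx (block a)) 1%:M s.

Arguments cont : simpl never.

Lemma cont_cons a s : cont (a :: s) = block a *m cont s. Proof. by []. Qed.

Lemma cont_cat s t : cont (s ++ t) = cont s *m cont t.
Proof.
elim: s => [|a s IH]; first by rewrite mul1mx.
by rewrite cat_cons !cont_cons IH mulmxA.
Qed.

Lemma det_cont s : \det (cont s) = (-1) ^+ size s.
Proof.
elim: s => [|a s IH]; first by rewrite det1.
by rewrite cont_cons det_mulmx IH det22 !mxE /= exprS; ring.
Qed.

Lemma cont00 a s : cont (a :: s) 0 0 = a%:Z * cont s 0 0 + cont s 1 0.
Proof. by rewrite cont_cons mulmx22 !mxE /=; ring. Qed.
Lemma cont01 a s : cont (a :: s) 0 1 = a%:Z * cont s 0 1 + cont s 1 1.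
Proof. by rewrite cont_cons mulmx22 !mxE /=; ring. Qed.
Lemma cont10 a s : cont (a :: s) 1 0 = cont s 0 0.
Proof. by rewrite cont_cons mulmx22 !mxE /=; ring. Qed.
Lemma cont11 a s : cont (a :: s) 1 1 = cont s 0 1.
Proof. by rewrite cont_cons mulmx22 !mxE /=; ring. Qed.
Definition contE := (cont00, cont01, cont10, cont11).

Lemma cont_nil00 : cont [::] 0 0 = 1. Proof. by rewrite mxE. Qed.
Lemma cont_nil01 : cont [::] 0 1 = 0. Proof. by rewrite mxE. Qed.
Lemma cont_nil10 : cont [::] 1 0 = 0. Proof. by rewrite mxE. Qed.
Lemma cont_nil11 : cont [::] 1 1 = 1. Proof. by rewrite mxE. Qed.
Definition cont_nilE := (cont_nil00, cont_nil01, cont_nil10, cont_nil11).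

Definition pos (s : seq nat) := all (leq 1) s.

Lemma cont_ge0 s : [/\ 0 <= cont s 0 0, 0 <= cont s 0 1, 0 <= cont s 1 0 & 0 <= cont s 1 1].
Proof.
elim: s => [|a s [h1 h2 h3 h4]]; first by rewrite !cont_nilE.
rewrite !contE; split=> //; nia.
Qed.

Lemma cont_gt0 s : pos s -> 0 < cont s 0 0.
Proof.
elim: s => [|a s IH] /=; first by rewrite cont_nilE.
case/andP=> a1 /IH h; rewrite contE; have [_ _ h3 _] := cont_ge0 s; nia.
Qed.

Lemma cont_le_rows s : pos s -> s != [::] -> cont s 1 0 <= cont s 0 0 /\ cont s 1 1 <= cont s 0 1.
Proof.
case: s => [//|a s] /= /andP[a1 ps] _; rewrite !contE.
have [h1 h2 h3 h4] := cont_ge0 s; split; nia.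
Qed.

Lemma cont_le_cols s : pos s -> s != [::] -> cont s 0 1 <= cont s 0 0 /\ cont s 1 1 <= cont s 1 0.
Proof.
elim: s => [//|a [|b s] IH] /= /andP[a1 ps] _.
  by rewrite !contE !cont_nilE; split; lia.
have {}IH := IH ps isT; rewrite (cont00 a) (cont01 a) (cont10 a) (cont11 a).
case: IH => h1 h2; split; [nia|exact: h1].
Qed.

Definition tr (s : seq nat) : int := \tr (cont s).

Lemma trE s : tr s = cont s 0 0 + cont s 1 1. Proof. exact: mxtrace22. Qed.

Lemma tr_cons a s : tr (a :: s) = a%:Z * cont s 0 0 + (cont s 0 1 + cont s 1 0).
Proof. by rewrite trE !contE; ring. Qed.

Lemma tr_rot i s : tr (rot i s) = tr s.
Proof. by rewrite /tr -{2}(cat_take_drop i s) /rot !cont_cat mxtrace_mulC. Qed.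

Definition good (s : seq nat) := [&& s != [::], ~~ odd (size s) & pos s].

Lemma good_rot i s : good (rot i s) = good s.
Proof.
rewrite /good size_rot /pos -!size_eq0 size_rot; congr [&& _, _ & _].
by apply/eq_all_r => x; rewrite mem_rot.
Qed.

(** Two further letters at least double the corner entry. This growth makes the length of a word
    logarithmic in its trace. *)
Lemma cont00_ge s : pos s -> (2 ^ (size s)./2)%:Z <= cont s 0 0.
Proof.
have [n] := ubnP (size s); elim: n s => // n IH [|a [|b s]] /=.
- by rewrite cont_nilE.
- by rewrite contE !cont_nilE => _ /andP[]; lia.
rewrite !ltnS => hs /and3P[a1 b1 ps]; rewrite !contE.
have := IH s (ltnW hs) ps; have [h1 h2 h3 h4] := cont_ge0 s.
rewrite expnS; move: (2 ^ _)%N => N hN.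
have hb : cont s 0 0 <= b%:Z * cont s 0 0 by nia.
have ha : b%:Z * cont s 0 0 + cont s 1 0 <= a%:Z * (b%:Z * cont s 0 0 + cont s 1 0) by nia.
by rewrite PoszM; lia.
Qed.

(** An odd length gives determinant -1, so the product of the off-diagonal entries exceeds that of
    the diagonal entries by 1; this forces both to be positive. *)
Lemma tail_facts r : pos r -> odd (size r) ->
  [/\ 0 < cont r 0 0, 0 < cont r 0 1, 0 < cont r 1 0, cont r 0 1 <= cont r 0 0 & cont r 1 0 <= cont r 0 0].
Proof.
move=> pr o; have r0 : r != [::] by case: r o {pr}.
have := det_cont r; rewrite det22 -signr_odd o /= expr1.
have [h1 _] := cont_le_rows pr r0; have [h2 _] := cont_le_cols pr r0.
have [H1 H2 H3 H4] := cont_ge0 r; have := cont_gt0 pr; split=> //; nia.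
Qed.

Lemma good_tail a r : good (a :: r) -> [/\ (0 < a)%N, pos r & odd (size r)].
Proof. by case/and3P=> _ /=; rewrite negbK => o /andP[]. Qed.

Lemma good_cons a r : (0 < a)%N -> pos r -> odd (size r) -> good (a :: r).
Proof. by move=> a0 pr o; rewrite /good /= o a0 /=. Qed.

Lemma good_size_ge2 s : good s -> (2 <= size s)%N.
Proof. by case: s => [|a [|b s]]. Qed.

Lemma tr_gt s : good s -> (2 ^ (size s)./2)%:Z < tr s.
Proof.
case: s => [//|a r] g; have [a0 pr o] := good_tail g.
have [] := tail_facts pr o => h1 h2 h3 h4 h5.
have H := @cont00_ge (a :: r) _; rewrite trE; rewrite (contE) in H *.
have : (2 ^ (size (a :: r))./2)%:Z <= a%:Z * cont r 0 0 + cont r 1 0 by apply: H; rewrite /= a0.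
by rewrite cont11; lia.
Qed.

Lemma tr_gt_size s : good s -> (size s)%:Z < tr s.
Proof.
move=> g; have := tr_gt g; have := good_size_ge2 g.
have : ~~ odd (size s) by case/and3P: g.
move=> o h; suff H : ((size s) <= 2 ^ (size s)./2)%N by move=> ?; lia.
rewrite -[leqLHS]even_halfK //; have : (0 < (size s)./2)%N by case: (size s) h o => [|[|[|n]]].
case: (_./2) => // n _; elim: n => // n IH.
by rewrite expnS doubleS; lia.
Qed.

Lemma tr_gt_head a r : good (a :: r) -> a%:Z < tr (a :: r).
Proof.
by move=> g; have [a0 pr o] := good_tail g; rewrite tr_cons; case: (tail_facts pr o); nia.
Qed.

Lemma tr_gt_mem s x : good s -> x \in s -> x%:Z < tr s.
Proof.
move=> g xs; have := rot_index xs; set r := _ ++ _ => e.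
by rewrite -(tr_rot (index x s)) e; apply: tr_gt_head; rewrite -e good_rot.
Qed.

(** * Enumeration of the words of bounded trace *)

Fixpoint lists (n V : nat) : seq (seq nat) :=
  if n is n'.+1 then [seq a :: s | s <- lists n' V, a <- iota 0 V] else [:: [::]].

Lemma mem_lists n V (s : seq nat) : (s \in lists n V) = (size s == n) && all (fun x => x < V)%N s.
Proof.
elim: n s => [|n IH] s /=; first by rewrite inE; case: s.
apply/allpairsP/idP => [[[t a] /= [ht ha ->]] /=|].
  by move: ht ha; rewrite IH mem_iota /= => /andP[/eqP-> ->] ->; rewrite eqxx.
case: s => [//|a t] /= /and3P[/eqP[e] ha ht]; exists (t, a).
by rewrite IH e eqxx ht mem_iota.
Qed.

Lemma uniq_lists n V : uniq (lists n V).
Proof.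
elim: n => //= n IH; apply: allpairs_uniq => //; first exact: iota_uniq.
by move=> [t a] [t' a'] _ _ /= [-> ->].
Qed.

Definition tails (N V : nat) : seq (seq nat) := flatten [seq lists n V | n <- iota 0 N].

Lemma mem_tails N V (s : seq nat) : (s \in tails N V) = (size s < N)%N && all (fun x => x < V)%N s.
Proof.
apply/flatten_mapP/idP => [[n]|/andP[h1 h2]].
  by rewrite mem_iota mem_lists /= => h /andP[/eqP-> ->]; rewrite h.
by exists (size s); rewrite ?mem_iota // mem_lists eqxx.
Qed.

Lemma uniq_tails N V : uniq (tails N V).
Proof.
rewrite /tails; elim: N => // N IH.
rewrite -addn1 iotaD map_cat flatten_cat /= cats0 cat_uniq IH uniq_lists andbT /=.
apply/hasPn => s; rewrite mem_lists add0n => /andP[/eqP e _].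
by rewrite -/(tails N V) mem_tails e ltnn.
Qed.

(** Cutting lengths and letters at [V] loses no word, since both are smaller than the trace. *)
Definition words (V : nat) : seq (seq nat) := [seq s <- tails V V | good s & tr s < V%:Z].

Lemma mem_words V (s : seq nat) : (s \in words V) = good s && (tr s < V%:Z).
Proof.
rewrite mem_filter mem_tails andbC; apply: andb_idl => /andP[g h].
have h1 := tr_gt_size g; apply/andP; split; first by lia.
by apply/allP => x xs; have := tr_gt_mem g xs; lia.
Qed.

Lemma uniq_words V : uniq (words V). Proof. by rewrite filter_uniq // uniq_tails. Qed.

Lemma rot_words V i (s : seq nat) : (rot i s \in words V) = (s \in words V).
Proof. by rewrite !mem_words good_rot tr_rot. Qed.

Lemma size_words V (s : seq nat) : s \in words V -> (size s <= V)%N.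
Proof. by rewrite mem_words => /andP[gs ts]; have := tr_gt_size gs; lia. Qed.

(** * Doubling of the weighted count *)

(** The common form of the counting arguments: a substitution in the words that is injective and
    does not decrease the summand. *)
Lemma ler_sum_inj (F : numDomainType) (T T' : eqType) (A : seq T) (B : seq T') (P : pred T)
    (Q : pred T') (h : T -> T') (f : T -> F) (g : T' -> F) :
  uniq A -> uniq B ->
  {in [pred x in A | P x] &, injective h} ->
  (forall x, x \in A -> P x -> [/\ h x \in B, Q (h x) & f x <= g (h x)]) ->
  (forall y, y \in B -> Q y -> 0 <= g y) ->
  \sum_(x <- A | P x) f x <= \sum_(y <- B | Q y) g y.
Proof.
move=> uA uB hi hm g0; rewrite -big_filter -[leRHS]big_filter.
set A' := [seq x <- A | P x]; set B' := [seq y <- B | Q y].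
have mA x : x \in A' -> [/\ h x \in B', h x \in B, Q (h x) & f x <= g (h x)].
  by rewrite !mem_filter => /andP[Px xA]; have [h1 h2 h3] := hm x xA Px; rewrite h1 h2.
have iA : {in A' &, injective h}.
  by move=> x y; rewrite !mem_filter => /andP[? ?] /andP[? ?]; apply: hi; rewrite inE; apply/andP.
apply: (@le_trans _ _ (\sum_(y <- map h A') g y)).
  by rewrite big_map !big_seq; apply: ler_sum => x /mA[].
rewrite [leRHS](bigID (mem (map h A'))) /= -[X in _ <= X + _]big_filter.
have H : perm_eq (map h A') [seq y <- B' | y \in map h A'].
  apply: uniq_perm; rewrite ?map_inj_in_uniq ?filter_uniq //.
  move=> y; rewrite [in RHS]mem_filter; case: (boolP (y \in map h A')) => //=.
  by move=> /mapP[x /mA[hx _ _ _] ->].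
rewrite (perm_big _ H) /=.
rewrite lerDl big_seq_cond; apply: sumr_ge0 => y /andP[].
by rewrite mem_filter => /andP[Qy yB] _; apply: g0.
Qed.

Lemma sum_lt (F : nmodType) (V n : nat) (f : nat -> F) : (n <= V)%N ->
  \sum_(0 <= i < V | (i < n)%N) f i = \sum_(i < n) f i.
Proof. by move=> h; rewrite -(big_mkord xpredT f) (big_nat_widen _ _ _ _ _ h). Qed.

Section Sums.
Variable F : realFieldType.
Implicit Types (g G : seq nat -> F).

Implicit Types s : seq nat.

Definition rotinv g := forall s, good s -> g (rot 1 s) = g s.

Lemma rotinv_rot g i s : rotinv g -> good s -> (i <= size s)%N -> g (rot i s) = g s.
Proof.
move=> H gs; elim: i => [|i IH] hi; first by rewrite rot0.
by rewrite rotS // H ?good_rot // IH // ltnW.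
Qed.

Lemma sum_rot V i g : \sum_(s <- words V) g (rot i s) = \sum_(s <- words V) g s.
Proof.
rewrite -(big_map (rot i) xpredT g); apply/perm_big/uniq_perm; rewrite ?uniq_words //.
  by rewrite map_inj_uniq ?uniq_words //; apply: rot_inj.
move=> s; apply/mapP/idP => [[t ht ->]|hs]; first by rewrite rot_words.
by exists (rotr i s); rewrite ?rotrK // -(rot_words V i) rotrK.
Qed.

Lemma head_rot i (s : seq nat) : (i < size s)%N -> head 0%N (rot i s) = nth 0%N s i.
Proof. by move=> h; rewrite /rot (drop_nth 0%N). Qed.

Lemma sum_count (p : pred nat) (s : seq nat) :
  (count p s)%:R = \sum_(i < size s) (p (nth 0%N s i))%:R :> F.
Proof.
by rewrite -sum1_count natr_sum big_mkcond (big_nth 0%N) big_mkord; apply: eq_bigr => i _; case: ifP.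
Qed.

(* Every word is rotated so that each of its letters comes first in turn. *)
Lemma head_avg V (p : pred nat) g : rotinv g ->
  \sum_(s <- words V | p (head 0%N s)) g s = \sum_(s <- words V) g s * (count p s)%:R / (size s)%:R.
Proof.
move=> H.
have E (h : seq nat -> nat -> F) : \sum_(s <- words V) \sum_(0 <= i < V | (i < size s)%N) h s i
    = \sum_(0 <= i < V) \sum_(s <- words V | (i < size s)%N) h s i.
  by rewrite (exchange_big_dep xpredT).
transitivity (\sum_(s <- words V) \sum_(0 <= i < V | (i < size s)%N)
    g s / (size s)%:R * (p (head 0%N (rot i s)))%:R); last first.
  rewrite !big_seq; apply: eq_bigr => s sW; have sV := size_words sW.
  rewrite -big_distrr /= sum_lt // mulrAC sum_count; congr (_ * _ / _); apply: eq_bigr => i _.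
  by rewrite head_rot.
rewrite E.
transitivity (\sum_(0 <= i < V) \sum_(s <- words V | (i < size s)%N) 
   g s / (size s)%:R * (p (head 0%N s))%:R).
  rewrite -E big_mkcond !big_seq; apply: eq_bigr => s sW; have sV := size_words sW.
  have s0 : (size s)%:R != 0 :> F by move: sW; rewrite mem_words pnatr_eq0 => /andP[/good_size_ge2]; case: (size s).
  rewrite sum_lt // sumr_const card_ord -[RHS]mulr_natr mulrAC divfK //.
  by case: (p _); rewrite ?mulr1 ?mulr0.
apply: eq_bigr => i _; rewrite big_mkcond [RHS]big_mkcond /=.
rewrite -(sum_rot _ i) big_seq [RHS]big_seq; apply: eq_bigr => s.
rewrite mem_words => /andP[gs _]; rewrite size_rot; case: ifP => // hi.
by rewrite rotinv_rot // ltnW.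
Qed.

(** Up to periodic words, a quarter of the number of classes: a class has half as many words as
    letters, and each word comes with two signs. *)
Definition weight V : F := \sum_(s <- words V) (size s)%:R^-1.

Lemma rotinv_size : rotinv (fun s => (size s)%:R^-1).
Proof. by move=> s _; rewrite size_rot. Qed.

Lemma weight_ge0 V : 0 <= weight V. Proof. by apply: sumr_ge0 => s _; rewrite invr_ge0. Qed.

Lemma weight_mono V V' : (V <= V')%N -> weight V <= weight V'.
Proof.
move=> h; apply: (@ler_sum_inj _ _ _ _ _ _ _ id); rewrite ?uniq_words //.
  by move=> s; rewrite !mem_words => /andP[-> H] _; split=> //; lia.
Qed.

Lemma weight_ge_half V : (4 <= V)%N -> 2^-1 <= weight V.
Proof.
move=> h; have := @ler_sum_inj F _ _ [:: [:: 1; 1]%N] (words V) xpredT xpredT id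
  (fun s => (size s)%:R^-1) (fun s => (size s)%:R^-1).
rewrite big_seq1; apply; rewrite ?uniq_words //.
move=> s; rewrite inE => /eqP-> _; split=> //; rewrite mem_words trE !contE !cont_nilE /=.
by rewrite ltz_nat; lia.
Qed.

(** The trace is affine in [a], with constant term at most twice the slope; because of this term,
    halving the letter gains only the factor 3/4. *)
Lemma tr_halve a r : good (a :: r) -> (2 <= a)%N -> 4 * tr (a./2 :: r) <= 3 * tr (a :: r).
Proof.
move=> g a2; have [_ pr o] := good_tail g; rewrite !tr_cons.
have [] := tail_facts pr o; have := odd_double_half a; have : (odd a <= 1)%N by case: odd.
have : (1 <= a./2)%N by lia.
move: (a./2) (odd a : nat) => h b h1 b1 <-; rewrite -addnn !PoszD; nia.
Qed.

Lemma tr_scale c a a' r : good (a :: r) -> (1 <= c)%N -> (a' <= c * a)%N ->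
  tr (a' :: r) <= c%:Z * tr (a :: r).
Proof.
move=> g c1 h; have [_ pr o] := good_tail g; rewrite !tr_cons.
have [h1 h2 h3 _ _] := tail_facts pr o.
have : a'%:Z * cont r 0 0 <= c%:Z * a%:Z * cont r 0 0 by rewrite ler_pM2r // -PoszM lez_nat.
by nia.
Qed.

Lemma tr_delete r : good r -> 4 * tr r <= 3 * tr [:: 1, 1 & r]%N.
Proof.
case: r => [//|a r] g; rewrite !trE !(cont00 1) !(cont11 1) ?(cont10 1) ?(cont01 1).
have pr : pos (a :: r) by case/and3P: g.
have [h1 h2 h3 h4] := cont_ge0 (a :: r).
have [_ h5] := cont_le_rows pr isT; have [h6 _] := cont_le_cols pr isT.
by lia.
Qed.

(** The new bound is 3V/4 rounded up. *)
Lemma lt_step (t t' : int) V : 4 * t' <= 3 * t -> t < V%:Z -> t' < ((3 * V + 3) %/ 4)%N%:Z.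
Proof. by lia. Qed.

(** A letter is recovered from its half and its parity, whence the factor 2. *)
Lemma sum_head_ge2 V : \sum_(s <- words V | (2 <= head 0 s)%N) (size s)%:R^-1 <= 2 * weight ((3 * V + 3) %/ 4).
Proof.
have part b : \sum_(s <- words V | (2 <= head 0 s)%N && (odd (head 0 s)%N == b)) (size s)%:R^-1
    <= weight ((3 * V + 3) %/ 4).
  apply: (@ler_sum_inj _ _ _ _ _ _ _ (fun s => (head 0 s)./2 :: behead s)); rewrite ?uniq_words //.
  - move=> [|a r] [|a' r'] //=; rewrite !inE /= ?andbF // => /andP[_ /andP[_ /eqP o]] /andP[_ /andP[_ /eqP o']].
    by case=> e ->; rewrite -(odd_double_half a) -(odd_double_half a') e o o'.
  - move=> [//|a r]; rewrite !mem_words /= => /andP[g t] /andP[a2 _]; split=> //.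
    have := tr_halve g a2; have [_ pr o] := good_tail g; move=> H.
    by rewrite good_cons //; lia.
rewrite (bigID (fun s => odd (head 0%N s) == true)) /= mulr_natl mulr2n lerD //.
apply: le_trans (part false); rewrite le_eqVlt; apply/orP; left; apply/eqP.
by apply: eq_bigl => s; case: odd.
Qed.

(** The term 1/2 is the weight of the word 1, 1, from which deletion would leave nothing. *)
Lemma sum_head_11 V : \sum_(s <- words V | (head 0 s == 1)%N && (head 0 (behead s) == 1)%N) (size s)%:R^-1
   <= 2^-1 + weight ((3 * V + 3) %/ 4).
Proof.
rewrite (bigID (fun s => size s == 2%N)) /=; apply: lerD.
  rewrite -[leRHS](big_seq1 +%R [:: 1; 1]%N (fun s => (size s)%:R^-1)).
  apply: (@ler_sum_inj _ _ _ _ _ _ _ id); rewrite ?uniq_words //.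
    move=> s _ /andP[/andP[]]; case: s => [//|a [//|b [|//]]] /= /eqP-> /eqP-> _.
    by split=> //; rewrite inE.
apply: (@ler_sum_inj _ _ _ _ _ _ _ (fun s => behead (behead s))); rewrite ?uniq_words //.
- move=> [|a [|b s]] [|a' [|b' s']] //=; rewrite !inE /= ?andbF // => /and3P[_ /andP[/eqP-> /eqP->] _].
  by move=> /and3P[_ /andP[/eqP-> /eqP->] _] ->.
- move=> [|a [|b s]]; rewrite ?mem_words ?andbF // => /andP[g t] /= /andP[/andP[/eqP e1 /eqP e2] h].
  rewrite {}e1 {}e2 in g t.
  have gs : good s by move: g h; clear t; case: s => [//|c s] /=; rewrite /good /= !negbK.
  have H := tr_delete gs; split=> //; first by rewrite gs /=; apply: lt_step t.
  rewrite lef_pV2 ?posrE ?ltr0n //; first by rewrite ler_nat; lia.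
  by have := good_size_ge2 gs; lia.
Qed.

(* If at least a quarter of the letters are >= 2, halving such a letter is
   2-to-1 and divides the trace by 4/3; otherwise there are many adjacent pairs
   of letters 1, whose deletion is injective on words marked at the pair. *)
Lemma weight_step V : weight V <= 10 * weight ((3 * V + 3) %/ 4) + 1.
Proof.
pose c s := (size s <= 4 * count (leq 2) s)%N.
have crot s : good s -> c (rot 1 s) = c s.
  by move=> _; rewrite /c size_rot; congr (_ <= 4 * _)%N; apply/permP; rewrite perm_rot.
have sz s : s \in words V -> 0 < (size s)%:R :> F.
  by rewrite mem_words ltr0n => /andP[/good_size_ge2]; case: size.
rewrite {1}/weight (bigID c) /=.
have H1 : \sum_(s <- words V | c s) (size s)%:R^-1 <= 8 * weight ((3 * V + 3) %/ 4).
  apply: (@le_trans _ _ (4 * \sum_(s <- words V | (2 <= head 0 s)%N) (size s)%:R^-1)); last first.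
    by have := sum_head_ge2 V; lra.
  rewrite (head_avg V (leq 2) rotinv_size) big_distrr /= big_mkcond !big_seq /=.
  apply: ler_sum => s sW; have s0 := sz _ sW; case: ifP => [h|_]; last first.
    by rewrite mulr_ge0 // mulr_ge0 ?invr_ge0 // mulr_ge0 ?invr_ge0.
  rewrite mulrA mulrCA -[leLHS]mulr1 -!mulrA ler_pM2l ?invr_gt0 // mulrA.
  by rewrite ler_pdivlMr // mul1r -natrM ler_nat.
pose G s : F := if c s then 0 else (size s)%:R^-1.
have Grot : rotinv G by move=> s gs; rewrite /G crot // size_rot.
have G0 s : 0 <= G s by rewrite /G; case: (c s); rewrite ?invr_ge0.
have H2 : \sum_(s <- words V | ~~ c s) (size s)%:R^-1 <= 1 + 2 * weight ((3 * V + 3) %/ 4).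
  apply: (@le_trans _ _ (2 * \sum_(s <- words V | (head 0 s == 1)%N && (head 0 (behead s) == 1)%N) G s)); last first.
    apply: (@le_trans _ _ (2 * (2^-1 + weight ((3 * V + 3) %/ 4)))); last by lra.
    rewrite ler_pM2l //; apply: le_trans (sum_head_11 V); apply: ler_sum => s _.
    by rewrite /G; case: (c s); rewrite ?invr_ge0.
  have E : \sum_(s <- words V | ~~ c s) (size s)%:R^-1 = \sum_(s <- words V) G s.
    by rewrite big_mkcond; apply: eq_bigr => s _; rewrite /G if_neg.
  have A : \sum_(s <- words V | (2 <= head 0 s)%N) G s <= 4^-1 * \sum_(s <- words V) G s.
    rewrite (head_avg V (leq 2) Grot) big_distrr /= !big_seq; apply: ler_sum => s sW.
    have s0 := sz _ sW; rewrite -mulrA mulrC; rewrite /G; case: (boolP (c s)) => [|h]; first by rewrite !mulr0.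
    rewrite ler_pM2r ?invr_gt0 // ler_pdivrMr // mulrC ler_pdivlMr // -natrM ler_nat.
    by move: h; rewrite /c -ltnNge mulnC => /ltnW.
  have B : \sum_(s <- words V | (2 <= head 0 (behead s))%N) G s = \sum_(s <- words V | (2 <= head 0 s)%N) G s.
    rewrite big_mkcond [RHS]big_mkcond -[RHS](sum_rot V 1) [LHS]big_seq [RHS]big_seq.
    apply: eq_bigr => s; rewrite mem_words => /andP[gs _]; rewrite Grot //.
    by case: s gs => [|a [|b s]].
  rewrite E.
  (* Unless the first two letters are both 1, one of them is at least 2. Each of these two cases
     carries at most a quarter of the total, so the pairs 1, 1 carry at least half of it. *)
  have C : \sum_(s <- words V) G s <= \sum_(s <- words V | (head 0 s == 1)%N && (head 0 (behead s) == 1)%N) G s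
     + (\sum_(s <- words V | (2 <= head 0 s)%N) G s + \sum_(s <- words V | (2 <= head 0 (behead s))%N) G s).
    rewrite [X in _ <= X + _]big_mkcond [X in _ <= _ + (X + _)]big_mkcond [X in _ <= _ + (_ + X)]big_mkcond /=.
    rewrite -!big_split /= big_seq [leRHS]big_seq; apply: ler_sum => s.
    rewrite mem_words => /andP[/and3P[]]; case: s => [//|a [//|b s]] _ _ /and3P[a0 b0 _] _ /=.
    have := G0 [:: a, b & s]; move: (G _) => x x0.
    by case: a b a0 b0 => [//|[|a]] [//|[|b]] _ _ /=; lra.
  by lra.
by lra.
Qed.

End Sums.

(** * Equidistribution of the alternating sum *)

(** [(x + m.-1) %/ m] is x/m rounded up, which jumps exactly after the multiples of m. *)
Lemma ceil_step (m x : nat) : (0 < m)%N ->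
  ((x + m.-1) %/ m + (m %| x) = (x.+1 + m.-1) %/ m)%N.
Proof.
case: m => // p _ /=; rewrite /dvdn.
have := divn_eq x p.+1; have := ltn_pmod x (ltn0Sn p).
move: (x %/ p.+1)%N (x %% p.+1)%N => q [|r] h ->.
  have -> : ((q * p.+1 + 0).+1 + p = q.+1 * p.+1)%N by lia.
  by rewrite mulnK // addn0 divnMDl // divn_small // addn0 addn1.
have -> : ((q * p.+1 + r.+1).+1 + p = q.+1 * p.+1 + r.+1)%N by lia.
have -> : (q * p.+1 + r.+1 + p = q.+1 * p.+1 + r)%N by lia.
by rewrite !divnMDl // !divn_small //; lia.
Qed.

Lemma count_multiples (m n e : nat) : (0 < m)%N ->
  (\sum_(0 <= i < n) (m %| i + e) + (e + m.-1) %/ m = (n + e + m.-1) %/ m)%N.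
Proof.
move=> m0; elim: n => [|n IH]; first by rewrite big_geq.
by rewrite big_nat_recr //= addnAC IH addSn ceil_step.
Qed.

Lemma lt_scale (c : nat) (t t' : int) (V : nat) : (0 < c)%N ->
  t' <= c%:Z * t -> t < V%:Z -> t' < (c * V)%N%:Z.
Proof. by move=> c0 h1 h2; apply: le_lt_trans h1 _; rewrite PoszM ltr_pM2l // ltz_nat. Qed.

Lemma ltn_trans_int (x V : nat) (t : int) : x%:Z < t -> t < V%:Z -> (x < V)%N.
Proof. by lia. Qed.

Section Sums2.
Variable F : realFieldType.
Implicit Types (g G : seq nat -> F) (s r : seq nat).
Local Notation weight := (weight F).

(** The additive 1 is at most twice the weight on the right: [6 <= V] keeps the reduced bound at
    least 4, so that the word 1, 1 of trace 3 is counted. *)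
Lemma weight_step' V : (6 <= V)%N -> weight V <= 12 * weight ((3 * V + 3) %/ 4).
Proof.
move=> h; have := weight_step F V; have : 2^-1 <= weight ((3 * V + 3) %/ 4) by apply: weight_ge_half; lia.
by lra.
Qed.

(** Three steps suffice because (3/4)^3 < 1/2, the condition on [V] leaving room for the roundings;
    1728 is 12^3. *)
Lemma weight_double V : (20 <= V)%N -> weight (2 * V) <= 1728 * weight V.
Proof.
move=> h; set U1 := ((3 * (2 * V) + 3) %/ 4)%N; set U2 := ((3 * U1 + 3) %/ 4)%N.
have h1 := @weight_step' (2 * V) ltac:(lia); have h2 := @weight_step' U1 ltac:(lia).
have h3 := @weight_step' U2 ltac:(lia).
have h4 : weight ((3 * U2 + 3) %/ 4) <= weight V by apply: weight_mono; lia.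
by rewrite -/U1 -/U2 in h1 h2 h3; lra.
Qed.

Lemma weight_scale K V : (20 <= V)%N -> weight (K * V) <= 1728 ^+ K * weight V.
Proof.
move=> h; apply: (@le_trans _ _ (weight (2 ^ K * V))).
  by apply: weight_mono; rewrite leq_mul2r ltnW ?orbT // ltn_expl.
elim: K => [|K IH]; first by rewrite mul1n expr0 mul1r.
rewrite expnS -mulnA exprS; apply: le_trans (weight_double _) _.
  by apply: leq_trans h _; rewrite leq_pmull // expn_gt0.
by rewrite -mulrA; apply: ler_wpM2l IH; rewrite ler0n.
Qed.

(** The first letter [a] may be replaced by 2a or by 2a + 1, both at most 3a; the two images are
    separated by parity. *)
Lemma weight_triple V : 2 * weight V <= weight (3 * V).
Proof.
have part (b : bool) : weight V <= \sum_(s <- words (3 * V) | odd (head 0%N s) == b) (size s)%:R^-1.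
  apply: (@ler_sum_inj _ _ _ _ _ _ _ (fun s => ((b + (head 0 s).*2)%N :: behead s))); rewrite ?uniq_words //.
  - move=> [|a r] [|a' r'] //=; rewrite !inE /= ?mem_words // => _ _ [/addnI/double_inj-> ->] //.
  - move=> [|a r]; rewrite ?mem_words // => /andP[g t] _; rewrite /= oddD odd_double oddb addbF eqxx.
    have [a0 pr o] := good_tail g; split=> //; apply/andP; split.
      by apply: good_cons => //; lia.
    have := @tr_scale 3 a (b + a.*2) r g isT ltac:(by case: b; lia).
    by move=> H; apply: lt_scale H t.
rewrite mulr_natl mulr2n {3}/weight (bigID (fun s => odd (head 0%N s) == true)) /=.
apply: lerD; first exact: (part true).
apply: le_trans (part false) _; rewrite le_eqVlt; apply/orP; left; apply/eqP.
by apply: eq_bigl => s; case: odd.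
Qed.

Lemma weight_pow3 k V : 2 ^+ k * weight V <= weight (3 ^ k * V).
Proof.
elim: k => [|k IH]; first by rewrite mul1r mul1n.
rewrite exprS expnS -mulrA -mulnA; apply: le_trans (weight_triple _).
by rewrite ler_pM2l.
Qed.

Lemma weight_infty (c : nat) : exists V0, forall V, (V0 <= V)%N -> c%:R <= weight V.
Proof.
exists (3 ^ c.+1 * 4)%N => V h; apply: le_trans (weight_mono _ h); apply: le_trans (weight_pow3 _ _).
have := @weight_ge_half F 4 isT => H.
apply: (@le_trans _ _ (2 ^+ c.+1 * 2^-1)); last by rewrite ler_pM2l ?exprn_gt0.
have -> : 2 ^+ c.+1 * 2^-1 = (2 ^ c)%:R :> F by rewrite exprS natrX; field.
by rewrite ler_nat ltnW // ltn_expl.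
Qed.

Lemma big_head_tail V (P : pred (seq nat)) g :
  \sum_(s <- words V | P s) g s =
  \sum_(r <- tails V V) \sum_(0 <= a < V | (a :: r \in words V) && P (a :: r)) g (a :: r).
Proof.
rewrite [RHS](_ : _ = \sum_(s <- [seq a :: r | r <- tails V V, a <- iota 0 V] | (s \in words V) && P s) g s); last first.
  rewrite [RHS]big_mkcond [RHS]big_allpairs_dep; apply: eq_bigr => r _.
  by rewrite /index_iota subn0 [LHS]big_mkcond.
rewrite -big_filter -[RHS]big_filter; apply/perm_big/uniq_perm.
- by rewrite filter_uniq // uniq_words.
- rewrite filter_uniq //; apply: allpairs_uniq; rewrite ?uniq_tails ?iota_uniq //.
  by move=> [r a] [r' a'] _ _ /= [-> ->].
move=> s; rewrite mem_filter [RHS]mem_filter; case: (P s) => //=; rewrite ?andbF //= andbT.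
apply/idP/andP => [sW|[]//]; split=> //; case: s sW => [|a r] sW; first by rewrite mem_words in sW.
apply/allpairsP; exists (r, a) => /=; split=> //.
  have := size_words sW; rewrite mem_tails /= => ->; apply/allP => x xr.
  by move: sW; rewrite mem_words => /andP[g' t]; have := @tr_gt_mem (a :: r) x g'; rewrite inE xr orbT => /(_ isT) h; apply: ltn_trans_int h t.
by move: sW; rewrite mem_iota mem_words => /andP[g' t]; apply: ltn_trans_int (tr_gt_head g') t.
Qed.

Lemma down_closed_sum (P : pred nat) K V : (forall a b, (a <= b)%N -> P b -> P a) ->
  exists A, forall h : nat -> F, \sum_(0 <= a < V | P a && (K <= a)%N) h a = \sum_(K <= a < A) h a.
Proof.
move=> PP; elim: V => [|V [A IH]].
  by exists 0%N => h; rewrite !big_geq.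
case: (boolP (P V)) => PV; last first.
  by exists A => h; rewrite -IH big_mkcond big_nat_recr //= (negPf PV) addr0 -big_mkcond.
exists V.+1 => h; rewrite [RHS](big_nat_widenl K 0) // [LHS]big_nat_cond [RHS]big_nat_cond.
apply: eq_bigl => a; case: (boolP (a < V.+1)%N) => //= ha.
by rewrite (PP _ _ _ PV).
Qed.

(** * Discrepancy of the alternating sum modulo m *)

Section Mod.
Variables (m : nat) (k : int).

Definition ind (c x : int) : F := (m %| x - c)%Z%:R.

Fixpoint alt s : int := if s is a :: r then a%:Z - alt r else 0.

Lemma alt_cat s t : alt (s ++ t) = alt s + (-1) ^+ size s * alt t.
Proof.
elim: s => [|a s IH] /=; first by rewrite expr0 mul1r add0r.
by rewrite IH exprS; ring.
Qed.

Lemma alt_rot1 s : good s -> alt (rot 1 s) = - alt s.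
Proof.
case: s => [//|a r] g; have [_ _ o] := good_tail g.
rewrite /rot /= drop0 take0 alt_cat /= -signr_odd o expr1; ring.
Qed.

(* Symmetrized under [alt s -> - alt s], the effect of rotating by one letter. *)
Definition disc s : F := ind k (alt s) + ind (- k) (alt s) - 2 * m%:R^-1.

Lemma indN c x : ind c (- x) = ind (- c) x.
Proof.
rewrite /ind; congr (_%:R); congr nat_of_bool.
by apply/idP/idP => /dvdzP[q h]; apply/dvdzP; exists (- q); lia.
Qed.

Lemma disc_rot1 : rotinv disc.
Proof. by move=> s gs; rewrite /disc alt_rot1 // !indN opprK; ring. Qed.

Hypothesis m0 : (0 < m)%N.

(** The multiples of m in an interval of n integers number n/m up to an error of at most 1. *)
Lemma progression_bound K A c : `| \sum_(K <= a < A) (ind c a%:Z - m%:R^-1) | <= 1.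
Proof.
have m1 : 0 < m%:R :> F by rewrite ltr0n.
rewrite sumrB sumr_const_nat.
(* The residue of [K - c] replaces [K - c] itself, so that divisibility can be counted over natural
   numbers. *)
pose e := `| ((K%:Z - c) %% m)%Z |%N.
have -> : \sum_(K <= a < A) ind c a%:Z = (\sum_(0 <= i < A - K) (m %| i + e))%N%:R.
  rewrite -{1}[K]add0n big_addn natr_sum; apply: eq_bigr => i _; rewrite /ind; congr (_%:R : F).
  congr nat_of_bool; rewrite -[RHS]/((m%:Z %| (i + e)%N%:Z)%Z) !PoszD.
  have -> : e%:Z = ((K%:Z - c) %% m)%Z by rewrite /e gez0_abs // modz_ge0 //; case: m m0.
  by rewrite -addrA; apply/idP/idP => /dvdzP[q hq]; apply/dvdzP;
     [exists (q - ((K%:Z - c) %/ m)%Z)|exists (q + ((K%:Z - c) %/ m)%Z)];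
     have := divz_eq (K%:Z - c) m; lia.
have := count_multiples (A - K) e m0; set N := (\sum_(0 <= i < _) _)%N => E.
have h1 : (N * m <= (A - K) + m)%N.
  have := leq_trunc_div (A - K + e + m.-1) m; rewrite -E mulnDl.
  have := ltn_ceil (e + m.-1) m0; rewrite mulSn; lia.
have h2 : (A - K <= N * m + m)%N.
  have := ltn_ceil (A - K + e + m.-1) m0; rewrite -E mulSn mulnDl.
  have := leq_trunc_div (e + m.-1) m; lia.
rewrite ler_norml -[_ *+ (A - K)]mulr_natr; move: h1 h2; rewrite -!(ler_nat F) !natrD !natrM => h1 h2.
have E2 : (A - K)%:R = m%:R^-1 * (A - K)%:R * m%:R :> F by rewrite mulrAC mulVf ?mul1r // gt_eqF.
set z := _ * _ in E2 *; rewrite E2 in h1 h2.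
by apply/andP; split; rewrite -(ler_pM2r m1) mulrBl ?mulN1r ?mul1r -/z; lra.
Qed.

Lemma disc_bound s : `|disc s| <= 2.
Proof.
have h1 : 0 <= m%:R^-1 :> F by rewrite invr_ge0 ler0n.
have h2 : m%:R^-1 <= 1 :> F by rewrite invf_le1 ?ltr0n // ler1n.
have i0 c x : 0 <= ind c x by rewrite ler0n.
have i1 c x : ind c x <= 1 by rewrite /ind; case: (_ %| _)%Z.
have := i0 k (alt s); have := i0 (- k) (alt s); have := i1 k (alt s); have := i1 (- k) (alt s).
by rewrite ler_norml /disc => *; apply/andP; split; lra.
Qed.

Variable K : nat.
Hypothesis K0 : (0 < K)%N.
Definition nbig s := count (leq K) s.

Lemma nbig_rot i s : nbig (rot i s) = nbig s.
Proof. by apply/permP; rewrite perm_rot. Qed.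

Lemma words_down V a b r : (K <= b <= a)%N -> a :: r \in words V -> b :: r \in words V.
Proof.
move=> /andP[h1 h2]; rewrite !mem_words => /andP[g t].
have [a0 pr o] := good_tail g; rewrite good_cons //; last by lia.
have := @tr_scale 1 a b r g isT ltac:(lia); lia.
Qed.

(** The marking: the left side spreads each word equally over its large letters, each of them
    rotated to the front, and the rotation average puts the shares together again. *)
Lemma big_weight V G : rotinv G ->
  \sum_(s <- words V | (K <= head 0 s)%N) G s / (nbig s)%:R =
  \sum_(s <- words V | (0 < nbig s)%N) G s / (size s)%:R.
Proof.
move=> H; rewrite (head_avg V (leq K)) => [|s gs]; last by rewrite H // nbig_rot.
rewrite [RHS]big_mkcond; apply: eq_bigr => s _; rewrite -/(nbig s).
case: posnP => [->|h]; first by rewrite mulr0 mul0r.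
by rewrite divfK // pnatr_eq0 -lt0n.
Qed.

Lemma sum_head_big V : \sum_(s <- words V | (K <= head 0 s)%N) (nbig s)%:R^-1 <= weight V.
Proof.
rewrite (eq_bigr (fun s => 1 / (nbig s)%:R)) => [|s _]; last by rewrite div1r.
rewrite (big_weight V (G := fun=> 1)) // /weight big_mkcond; apply: ler_sum => s _.
by case: ifP; rewrite ?div1r ?invr_ge0.
Qed.

(** The letter [K] can be replaced by each of the [K] letters [K + i], [i < K]. The images are
    disjoint, the trace at most doubles, and the number of large letters stays the same. *)
Lemma sum_head_K V : K%:R * \sum_(s <- words V | head 0%N s == K) (nbig s)%:R^-1 <= weight (2 * V).
Proof.
have part i : (i < K)%N -> \sum_(s <- words V | head 0%N s == K) (nbig s)%:R^-1 <=
    \sum_(s <- words (2 * V) | head 0%N s == (K + i)%N) (nbig s)%:R^-1 :> F.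
  move=> hi; apply: (@ler_sum_inj _ _ _ _ _ _ _ (fun s => (K + i)%N :: behead s)); rewrite ?uniq_words //.
  - move=> [|a r] [|a' r'] //=; rewrite !inE /= ?mem_words // => /andP[_ /eqP->] /andP[_ /eqP->] [->] //.
  - move=> [|a r]; rewrite ?mem_words // => /andP[g t] /= /eqP e; rewrite {}e in g t *.
    have [a0 pr o] := good_tail g; split=> //; last by rewrite /nbig /= leqnn leq_addr.
    rewrite good_cons //=; last by rewrite addn_gt0 K0.
    have := @tr_scale 2 K (K + i) r g isT ltac:(lia).
    by move=> H; apply: lt_scale H t.
apply: le_trans (sum_head_big (2 * V)).
apply: (@le_trans _ _ (\sum_(i < K) \sum_(s <- words (2 * V) | head 0%N s == (K + i)%N) (nbig s)%:R^-1)).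
  rewrite mulr_natl -[X in _ *+ X](card_ord K) -sumr_const; apply: ler_sum => i _; exact: part.
rewrite (exchange_big_dep (fun s => K <= head 0 s)%N) /=; last by move=> i s _ /eqP->; rewrite leq_addr.
apply: ler_sum => s hs; rewrite sumr_const -[leLHS]mulr_natr ler_piMr ?invr_ge0 // lern1.
apply/card_le1_eqP => i j; rewrite !unfold_in => /eqP h1 /eqP h2; apply/val_inj/(@addnI K).
by rewrite -h1 -h2.
Qed.

(** With the tail fixed, [nbig] is the same for all large first letters, and [disc] sums over an
    interval of them to at most 2, one for each of the residues [k] and [- k]. A nonempty interval
    contains [K], and the error is charged to that word. *)
Lemma disc_big V : `| \sum_(s <- words V | (K <= head 0 s)%N) disc s / (nbig s)%:R | <=
  2 * \sum_(s <- words V | head 0%N s == K) (nbig s)%:R^-1.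
Proof.
rewrite big_head_tail; apply: le_trans (ler_norm_sum _ _ _) _.
apply: (@le_trans _ _ (\sum_(r <- tails V V | K :: r \in words V) 2 * (nbig (K :: r))%:R^-1)); last first.
  rewrite -big_distrr /= ler_pM2l //.
  apply: (@ler_sum_inj _ _ _ _ _ _ _ (cons K)); rewrite ?uniq_words ?uniq_tails //.
    by move=> r r' _ _ [].
rewrite [leRHS]big_mkcond; apply: ler_sum => r _.
case: (boolP (K :: r \in words V)) => h; last first.
  rewrite big1 ?normr0 // => a /andP[h1 /= h2]; case/negP: h.
  by apply: words_down h1; rewrite leqnn.
(* [maxn K] extends the condition to letters below [K], where [words_down] says nothing, and makes
   it downward closed everywhere. *)
have PP a b : (a <= b)%N -> maxn K b :: r \in words V -> maxn K a :: r \in words V.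
  by move=> ab; apply: words_down; lia.
have [A HA] := down_closed_sum K V PP.
have -> : \sum_(0 <= a < V | (a :: r \in words V) && (K <= head 0 (a :: r))%N) disc (a :: r) / (nbig (a :: r))%:R
   = (\sum_(K <= a < A) (disc (a :: r))) / (nbig (K :: r))%:R.
  rewrite -HA big_distrl /=; apply: congr_big => //.
    by move=> a; case: (leqP K a) => h'; rewrite ?andbF //; rewrite (maxn_idPr h').
  by move=> a /andP[_ h']; rewrite /nbig /= h' leqnn.
rewrite normrM [X in _ * X]ger0_norm ?invr_ge0 // ler_wpM2r ?invr_ge0 //.
rewrite (eq_bigr (fun a : nat => (ind (k + alt r) a - m%:R^-1) + (ind (- k + alt r) a - m%:R^-1))); last first.
  have E c (a : nat) : ind c (a%:Z - alt r) = ind (c + alt r) a by rewrite /ind opprD addrA addrAC.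
  by move=> a _; rewrite /disc /= !E; ring.
rewrite big_split /=; apply: le_trans (ler_normD _ _) _.
by have := progression_bound K A (k + alt r); have := progression_bound K A (- k + alt r); lra.
Qed.

(** Words shorter than [n0] are among finitely many, independently of [V]; the others weigh at most
    [n0%:R^-1] each, and it remains to bound their number. *)
Lemma sum_nobig V n0 : (0 < n0)%N -> \sum_(s <- words V | nbig s == 0%N) (size s)%:R^-1 <=
  (size (tails n0 K))%:R + K%:R / n0%:R * weight (K * V).
Proof.
move=> n00; rewrite (bigID (fun s => size s < n0)%N) /=; apply: lerD.
  rewrite -sum1_size natr_sum; apply: (@ler_sum_inj _ _ _ _ _ _ _ id); rewrite ?uniq_words ?uniq_tails //.
  move=> s sW /andP[h1 h2]; split=> //.
    rewrite mem_tails h2; apply/allP => x xs; rewrite ltnNge; apply/negP => Kx.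
    by move: h1; rewrite eqn0Ngt -has_count => /hasP[]; exists x.
  by rewrite invf_le1 ?ler1n ?ltr0n; move: sW; rewrite mem_words => /andP[/good_size_ge2]; case: size.
(* The first letter, which is below [K], is replaced by [K] and remembered separately. The new word
   has a single large letter, hence mark 1, and its trace has grown at most by the factor [K]. *)
have H : \sum_(s <- words V | nbig s == 0%N) 1 <= K%:R * weight (K * V).
  apply: (@le_trans _ _ (\sum_(p <- [seq (i, s) | i <- iota 0 K, s <- words (K * V)] | (K <= head 0 p.2)%N)
     (nbig p.2)%:R^-1)); last first.
    rewrite big_mkcond big_allpairs /=.
    rewrite (eq_bigr (fun=> \sum_(s <- words (K * V) | (K <= head 0 s)%N) (nbig s)%:R^-1)); last first.
      by move=> i _; rewrite [RHS]big_mkcond.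
    rewrite big_const_seq count_predT size_iota iter_addr_0 -[leLHS]mulr_natl ler_wpM2l //.
    exact: sum_head_big.
  apply: (@ler_sum_inj _ _ _ _ _ _ _ (fun s => (head 0%N s, K :: behead s))); rewrite ?uniq_words //.
  - by apply: allpairs_uniq; rewrite ?iota_uniq ?uniq_words // => -[i s] [i' s'] _ _ [-> ->].
  - by move=> [|a r] [|a' r'] //=; rewrite !inE /= ?mem_words // => _ _ [-> ->].
  - move=> [|a r]; rewrite ?mem_words // => /andP[g t] /=; rewrite /nbig /= addn_eq0 => /andP[h1 h2].
    have [a0 pr o] := good_tail g; split=> //; last by rewrite leqnn (eqP h2) invr1.
    apply/allpairsP; exists (a, K :: r); split=> //=; rewrite ?mem_iota ?add0n ?mem_words.
      by rewrite /= ltnNge; case: leqP h1.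
    rewrite good_cons //=; have := @tr_scale K a K r g K0 ltac:(by rewrite leq_pmulr).
    by move=> H; apply: lt_scale H t.
apply: (@le_trans _ _ (n0%:R^-1 * \sum_(s <- words V | nbig s == 0%N) 1)); last first.
  by rewrite -mulrA [leRHS]mulrCA ler_wpM2l ?invr_ge0.
rewrite big_distrr /= big_mkcond [leRHS]big_mkcond; apply: ler_sum => s _.
case: (_ == _) => //=; case: ltnP => h /=; first by rewrite mulr1 invr_ge0.
by rewrite mulr1 lef_pV2 ?posrE ?ltr0n ?ler_nat //; apply: leq_trans h.
Qed.

Definition disc_sum V : F := \sum_(s <- words V) disc s / (size s)%:R.

Lemma disc_sum_bound V n0 : (20 <= V)%N -> (0 < n0)%N ->
  `|disc_sum V| <= 2 * (size (tails n0 K))%:R +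
    2 * (K%:R / n0%:R * 1728 ^+ K + 1728 / K%:R) * weight V.
Proof.
move=> V20 n00; rewrite /disc_sum (bigID (fun s => nbig s == 0%N)) /=.
apply: le_trans (ler_normD _ _) _.
have K0' : 0 < K%:R :> F by rewrite ltr0n.
have A : `|\sum_(s <- words V | nbig s == 0%N) disc s / (size s)%:R| <=
   2 * ((size (tails n0 K))%:R + K%:R / n0%:R * weight (K * V)).
  apply: (@le_trans _ _ (2 * \sum_(s <- words V | nbig s == 0%N) (size s)%:R^-1)); last first.
    by rewrite ler_pM2l // sum_nobig.
  rewrite big_distrr /=; apply: le_trans (ler_norm_sum _ _ _) _; apply: ler_sum => s _.
  by rewrite normrM [X in _ * X]ger0_norm ?invr_ge0 // ler_wpM2r ?invr_ge0 // disc_bound.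
have B : `|\sum_(s <- words V | nbig s != 0%N) disc s / (size s)%:R| <= 2 * (1728 * weight V / K%:R).
  rewrite (eq_bigl (fun s => 0 < nbig s)%N) => [|s]; last by rewrite lt0n.
  rewrite -(big_weight V disc_rot1); apply: le_trans (disc_big V) _.
  rewrite ler_pM2l // ler_pdivlMr // mulrC; apply: le_trans (sum_head_K V) _.
  exact: weight_double.
have C : K%:R / n0%:R * weight (K * V) <= K%:R / n0%:R * (1728 ^+ K * weight V).
  by rewrite ler_wpM2l ?divr_ge0 // weight_scale.
rewrite mulrA in C; apply: le_trans (lerD A B) _; move: (1728 ^+ K) C => x C.
move: (K%:R / n0%:R) C => y C; have -> : 1728 * weight V / K%:R = 1728 / K%:R * weight V by rewrite mulrAC.
by move: (1728 / K%:R) => z; lra.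
Qed.

End Mod.

Lemma disc_sum_small m k E : (0 < m)%N ->
  exists V0, forall V, (V0 <= V)%N -> E%:R * `|disc_sum m k V| <= weight V.
Proof.
(* The bound of [disc_sum_bound] has three terms, each with a factor 2. The 6 in each constant makes
   [E] times each term at most a third of the weight; [n0] comes after [K] because it must beat
   [1728 ^ K]. *)
move=> m0; pose K := (6 * 1728 * E).+1; pose n0 := (6 * E * K * 1728 ^ K).+1.
pose c := (6 * E * size (tails n0 K))%N.
have [V0 HV] := weight_infty c; exists (maxn V0 20) => V; rewrite geq_max => /andP[/HV h1 h2].
have := @disc_sum_bound m k m0 K isT V n0 h2 isT.
have K0 : 0 < K%:R :> F by rewrite ltr0n.
have N0 : 0 < n0%:R :> F by rewrite ltr0n.
have T0 := weight_ge0 F V.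
have A : 6 * E%:R * (1728 / K%:R) <= 1 :> F.
  rewrite mulrA ler_pdivrMr // mul1r -!natrM ler_nat /K; lia.
have B : 6 * E%:R * (K%:R / n0%:R * 1728 ^+ K) <= 1 :> F.
  have -> (x : F) : 6 * E%:R * (K%:R / n0%:R * x) = 6 * E%:R * K%:R * x / n0%:R by ring.
  by rewrite ler_pdivrMr // mul1r -natrX -!natrM ler_nat /n0 leqnSn.
rewrite /c !natrM in h1.
move: (size _)%:R h1 (_ / _ * _) B (_ / _) A `|_| => x h1 y B z A d hd.
have : E%:R * d <= E%:R * (2 * x + 2 * (y + z) * weight V) by rewrite ler_wpM2l.
have A' := ler_wpM2r T0 A; have B' := ler_wpM2r T0 B.
by move/le_trans; apply; lra.
Qed.

End Sums2.

(** * Periodic words are rare *)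

(* Only even rotations count: an odd one exchanges the roles of R and L. *)
Definition periodic (s : seq nat) :=
  has (fun i => ~~ odd i && (rot i s == s)) (iota 1 (size s).-1).

Lemma periodicP (s : seq nat) :
  reflect (exists2 i, [&& 0 < i, i < size s & ~~ odd i]%N & rot i s = s) (periodic s).
Proof.
apply: (iffP hasP) => H; case: H => i.
  rewrite mem_iota => /andP[h1 h2] /andP[h3 /eqP h4]; exists i => //.
  by apply/and3P; split=> //; lia.
by move=> /and3P[h1 h2 h3] h; exists i; rewrite ?h3 ?h ?eqxx // mem_iota h1 /=; lia.
Qed.

(** As long as [t] is at least as long as [u], a copy of [u] splits off at its front, and the rest
    commutes with [u] again. *)
Lemma commute_prefix (T : eqType) (u t : seq T) n : u != [::] -> (size t <= n)%N ->
  t ++ u = u ++ t -> t = take (size t) (flatten (nseq n u)).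
Proof.
move=> u0; elim: n t => [|n IH] t ht E.
  by case: t ht {E}.
case: (ltnP (size t) (size u)) => h /=.
  have := congr1 (take (size t)) E; rewrite take_size_cat // takel_cat; last exact: ltnW.
  by rewrite takel_cat // ltnW.
have et : t = u ++ drop (size u) t.
  have := congr1 (take (size u)) E; rewrite [RHS]take_size_cat // takel_cat // => e.
  by rewrite -{1}e cat_take_drop.
rewrite et size_cat take_cat ltnNge leq_addr /= addKn; congr (_ ++ _); apply: IH.
  by rewrite size_drop; move: u0 ht; rewrite -size_eq0; lia.
by move: E; rewrite {1 2}et -catA => /eqP; rewrite eqseq_cat // => /andP[_ /eqP].
Qed.

(** Hence such a word is determined by its length and its first [i] letters, even when [i] does not
    divide the length. *)
Lemma rot_fix_prefix (s : seq nat) i n : (0 < i)%N -> (i <= size s <= n)%N -> rot i s = s ->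
  s = take (size s) (flatten (nseq n.+1 (take i s))).
Proof.
move=> i0 /andP[h1 h2]; rewrite /rot => E.
have su : size (take i s) = i by rewrite size_takel.
rewrite -{1}(cat_take_drop i s) /= take_cat su ltnNge h1 /= -(size_drop i s); congr (_ ++ _).
apply: commute_prefix; first by rewrite -size_eq0 su -lt0n.
  by apply: leq_trans h2; rewrite size_drop leq_subr.
by rewrite cat_take_drop.
Qed.

(** Rotation by [size s - i] fixes the word as well, and the smaller of the two rotations is
    taken. *)
Lemma periodic_half (s : seq nat) : ~~ odd (size s) -> periodic s ->
  exists2 i, [&& 0 < i, i.*2 <= size s & ~~ odd i]%N & rot i s = s.
Proof.
move=> o /periodicP[i /and3P[h1 h2 h3] h]; case: (leqP i.*2 (size s)) => h4.
  by exists i => //; apply/and3P.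
exists (size s - i)%N; first by rewrite oddB ?(negPf o) ?(negPf h3) //; lia.
by apply: (@rot_inj i); rewrite -/(rotr i s) rotrK h.
Qed.

(** The word begins with two copies of [take i s], and the corner entry of nonnegative matrices is
    supermultiplicative. *)
Lemma cont00_square (s : seq nat) i : (0 < i)%N -> (i.*2 <= size s)%N -> rot i s = s -> pos s ->
  cont (take i s) 0 0 * cont (take i s) 0 0 <= cont s 0 0.
Proof.
move=> i0 h E ps; have su : size (take i s) = i by rewrite size_takel //; lia.
have E2 : take i (drop i s) = take i s.
  by rewrite -{2}E /rot takel_cat // size_drop; lia.
have -> : cont s = cont (take i s) *m (cont (take i s) *m cont (drop i (drop i s))).
  by rewrite -!cont_cat -{2}E2 !cat_take_drop.
have pr : pos (drop i (drop i s)).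
  by apply/allP => x /mem_drop/mem_drop xs; apply: (allP ps).
move: (drop i _) pr (take i s) => r pr u; rewrite !mulmx22.
have [a1 a2 a3 a4] := cont_ge0 u; have [b1 b2 b3 b4] := cont_ge0 r; have := cont_gt0 pr.
move=> b0.
have h1 : cont u 0 0 <= cont u 0 0 * cont r 0 0 by nia.
have h2 : 0 <= cont u 0 1 * cont r 1 0 by nia.
have h3 : 0 <= cont u 1 0 * cont r 0 0 + cont u 1 1 * cont r 1 0 by nia.
rewrite -[leLHS]addr0; apply: lerD; [apply: ler_wpM2l => //|exact: mulr_ge0].
by rewrite -[leLHS]addr0 lerD.
Qed.

Section Count.
Variable F : realFieldType.
Local Notation weight := (weight F).

Lemma size_bound k V (s : seq nat) : (V <= 9 ^ k)%N -> s \in words V -> (size s < 8 * k)%N.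
Proof.
move=> hV; rewrite mem_words => /andP[g t]; have h := tr_gt g.
have : (2 ^ (size s)./2 < 2 ^ (4 * k))%N.
  apply: (@leq_trans (9 ^ k)); last first.
    by rewrite expnM; case: (k) => // n; rewrite leq_exp2r.
  by apply: leq_trans hV; apply: ltn_trans_int h t.
rewrite ltn_exp2l // => h2.
have : ~~ odd (size s) by case/and3P: g.
by move=> o; rewrite -[X in (X < _)%N](even_halfK o); lia.
Qed.

(** A periodic word is determined by its length, below [L], and a prefix whose corner entry is below
    3^(k+1), the square root of the trace bound; the prefix then has trace below [X], twice that
    number. The second factor [L] converts the number of prefixes into weight. *)
Lemma periodic_count k V : (V <= 9 ^ k.+1)%N ->
  \sum_(s <- words V | periodic s) 1 <= (8 * k.+1)%:R ^+ 2 * weight (6 * 3 ^ k).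
Proof.
move=> hV; set L := (8 * k.+1)%N; set X := (6 * 3 ^ k)%N.
have XV : (X <= 9 ^ k.+1)%N.
  rewrite /X (expnMn 3 3 k.+1) expnS; have : (3 <= 3 ^ k.+1)%N by rewrite expnS leq_pmulr ?expn_gt0.
  by rewrite expnS; move: (3 ^ k)%N => y; nia.
have A : (size [seq s <- words V | periodic s] <= size [seq (u, n) | u <- words X, n <- iota 0 L])%N.
  rewrite -(size_map (fun p => take p.2 (flatten (nseq L.+1 p.1))) [seq _ | u <- _, n <- _]).
  apply: uniq_leq_size; first by rewrite filter_uniq // uniq_words.
  move=> s; rewrite mem_filter => /andP[per sW].
  have sL : (size s < L)%N by apply: size_bound sW.
  have := sW; rewrite mem_words => /andP[g t].
  have [_ o ps] := and3P g.
  have [i /and3P[i0 i2 oi] E] := periodic_half o per.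
  have hi : (i <= size s <= L)%N by rewrite (ltnW sL) andbT; apply: leq_trans i2; rewrite -addnn leq_addr.
  have H := rot_fix_prefix i0 hi E.
  have su : size (take i s) = i by rewrite size_takel //; case/andP: hi.
  have pu : pos (take i s) by apply/allP => x /mem_take xs; apply: (allP ps).
  apply/mapP; exists (take i s, size s); last first.
    exact: H.
  apply/allpairsP; exists (take i s, size s); split; rewrite ?mem_iota //.
  rewrite mem_words /=; apply/andP; split.
    by rewrite /good -size_eq0 su oi pu andbT -lt0n i0.
  have u0 : take i s != [::] by rewrite -size_eq0 su -lt0n.
  have [_ c1] := cont_le_rows pu u0; have [c2 _] := cont_le_cols pu u0.
  have sq := cont00_square i0 i2 E ps; have cp := cont_gt0 pu.
  have sV : cont s 0 0 < (3 ^ k.+1 * 3 ^ k.+1)%N%:Z.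
    rewrite -expnMn; apply: lt_le_trans (_ : V%:Z <= _); last by rewrite lez_nat.
    by apply: le_lt_trans t; rewrite trE lerDl; case: (cont_ge0 s).
  move: sV sq cp c1 c2; rewrite trE /X expnS !PoszM; move: (3 ^ k)%N (cont s _ _) => y z.
  move: (cont _ 0 0) (cont _ 0 1) (cont _ 1 1) => a b d h1 h2 h3 h4 h5.
  have h6 : a < 3%N%:Z * y%:Z.
    rewrite ltNge; apply/negP => h6; have y0 : 0 <= 3%N%:Z * y%:Z by [].
    by have := ler_pM y0 y0 h6 h6; rewrite leNgt (le_lt_trans h2 h1).
  by clear h1 h2; lia.
have B : (size (words X))%:R <= L%:R * weight X.
  rewrite -sum1_size natr_sum big_distrr /= !big_seq; apply: ler_sum => s sW.
  have s0 : 0 < (size s)%:R :> F.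
    by rewrite ltr0n; move: sW; rewrite mem_words => /andP[/good_size_ge2]; case: size.
  by rewrite ler_pdivlMr // mul1r ler_nat ltnW //; apply: size_bound sW.
rewrite -big_filter (eq_bigr (fun=> 1%:R)) // -natr_sum sum1_size.
apply: (@le_trans _ _ ((size (words X))%:R * L%:R)).
  by rewrite -natrM ler_nat; apply: leq_trans A _; rewrite size_allpairs size_iota.
by rewrite mulrC expr2 -mulrA ler_wpM2l.
Qed.

Lemma pow3_le_pow2 n : ((n.+1) ^ 3 <= 16 * 2 ^ n)%N.
Proof.
have [|] := ltnP n 3; first by case: n => [|[|[|]]].
move=> h; rewrite -(subnK h); elim: (n - 3)%N => // m IH.
rewrite addSn expnS; move: IH; rewrite (expnS 2); set y := (2 ^ _)%N; move: y; nia.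
Qed.

Lemma periodic_small E : exists V0, forall V, (V0 <= V)%N ->
  E%:R * \sum_(s <- words V | periodic s) 1 <= weight V.
Proof.
(* 64 is the square of 8 in the length bound, 4 compares [2 ^ k] with [2 ^ (k - 2)], and 16 comes
   from [pow3_le_pow2]: for [k >= k0] one factor of the cube of k + 1 absorbs them all. *)
pose k0 := (E * 64 * 4 * 16 + 2)%N; exists (9 ^ k0)%N => V hV.
have V0 : (0 < V)%N by apply: leq_trans hV; rewrite expn_gt0.
have [k /andP[k1 k2]] : exists k, (9 ^ k <= V < 9 ^ k.+1)%N.
  by exists (trunc_log 9 V); apply: trunc_log_bounds.
have kk : (k0 <= k)%N.
  by rewrite -ltnS -(@ltn_exp2l 9) //; apply: leq_ltn_trans hV k2.
have A := periodic_count (ltnW k2).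
(* The bound [6 * 3 ^ k] can be tripled k - 2 times within [9 ^ k], and each tripling at least
   doubles the weight. *)
have B : 2 ^+ (k - 2) * weight (6 * 3 ^ k) <= weight V.
  apply: le_trans (weight_pow3 _ _ _) _; apply: weight_mono; apply: leq_trans k1.
  have -> : (k = (k - 2) + 2)%N by rewrite /k0 in kk; lia.
  rewrite addnK; move: (k - 2)%N => n; rewrite (expnMn 3 3) !expnD; lia.
have C : (E * (8 * k.+1) ^ 2 <= 2 ^ (k - 2))%N.
  have := pow3_le_pow2 k; have -> : (2 ^ k = 4 * 2 ^ (k - 2))%N.
    by rewrite -(expnD 2 2) subnKC //; rewrite /k0 in kk; lia.
  move: (2 ^ _)%N => y; rewrite /k0 in kk; nia.
apply: le_trans B; apply: (@le_trans _ _ (E%:R * ((8 * k.+1)%:R ^+ 2 * weight (6 * 3 ^ k)))).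
  by rewrite ler_wpM2l.
by rewrite mulrA ler_wpM2r ?weight_ge0 // -!natrX -natrM ler_nat.
Qed.

End Count.

(** * Words in the two parabolic generators *)

Definition mx2 (a b c d : int) : 'M[int]_2 :=
  \matrix_(i, j) (if i == 0 then (if j == 0 then a else b) else (if j == 0 then c else d)).

Lemma mx2_00 a b c d : mx2 a b c d 0 0 = a. Proof. by rewrite mxE. Qed.
Lemma mx2_01 a b c d : mx2 a b c d 0 1 = b. Proof. by rewrite mxE. Qed.
Lemma mx2_10 a b c d : mx2 a b c d 1 0 = c. Proof. by rewrite mxE. Qed.
Lemma mx2_11 a b c d : mx2 a b c d 1 1 = d. Proof. by rewrite mxE. Qed.
Definition mx2E := (mx2_00, mx2_01, mx2_10, mx2_11).

Lemma eq_mx22 (A B : 'M[int]_2) : A 0 0 = B 0 0 -> A 0 1 = B 0 1 -> A 1 0 = B 1 0 ->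
  A 1 1 = B 1 1 -> A = B.
Proof.
move=> h1 h2 h3 h4; apply/matrixP => i j.
have ord2 (k : 'I_2) : k = 0 \/ k = 1.
  by case: k => [[|[|//]] hk]; [left|right]; apply: val_inj.
by case: (ord2 i) => ->; case: (ord2 j) => ->.
Qed.

Lemma mx2_eta (A : 'M[int]_2) : A = mx2 (A 0 0) (A 0 1) (A 1 0) (A 1 1).
Proof. by apply: eq_mx22; rewrite mx2E. Qed.

Lemma mul_mx2 a b c d a' b' c' d' : mx2 a b c d *m mx2 a' b' c' d' =
  mx2 (a * a' + b * c') (a * b' + b * d') (c * a' + d * c') (c * b' + d * d').
Proof. by apply: eq_mx22; rewrite mulmx22 !mx2E. Qed.

Lemma det_mx2 a b c d : \det (mx2 a b c d) = a * d - b * c.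
Proof. by rewrite det22 !mx2E. Qed.

Lemma mx2_1 : 1%:M = mx2 1 0 0 1.
Proof. by apply: eq_mx22; rewrite mx2E mxE. Qed.

Definition ge0mx (A : 'M[int]_2) := [&& 0 <= A 0 0, 0 <= A 0 1, 0 <= A 1 0 & 0 <= A 1 1].

Lemma ge0mx_mul A B : ge0mx A -> ge0mx B -> ge0mx (A *m B).
Proof.
move=> /and4P[a b c d] /and4P[a' b' c' d']; rewrite /ge0mx !mulmx22.
by rewrite !addr_ge0 // mulr_ge0.
Qed.

Lemma ge0mx_cont s : ge0mx (cont s).
Proof. by apply/and4P; case: (cont_ge0 s). Qed.

(* [gen_mx true a] is R^a and [gen_mx false a] is L^a. *)
Definition gen_mx (b : bool) (a : nat) : 'M[int]_2 := if b then mx2 1 a%:Z 0 1 else mx2 1 0 a%:Z 1.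

Arguments gen_mx : simpl never.

Fixpoint word_mx (b : bool) (s : seq nat) : 'M[int]_2 :=
  if s is a :: t then gen_mx b a *m word_mx (~~ b) t else 1%:M.

Lemma gen_mxD b a c : gen_mx b (a + c) = gen_mx b a *m gen_mx b c.
Proof. by case: b; rewrite /gen_mx mul_mx2; apply: eq_mx22; rewrite !mx2E ?PoszD; ring. Qed.

Lemma ge0mx_word_mx b s : ge0mx (word_mx b s).
Proof.
elim: s b => [|a s IH] b /=; first by rewrite mx2_1 /ge0mx !mx2E.
by apply: ge0mx_mul => //; case: b; rewrite /gen_mx /ge0mx !mx2E.
Qed.

Lemma det_gen_mx b a : \det (gen_mx b a) = 1.
Proof. by case: b; rewrite /gen_mx det_mx2; ring. Qed.

Lemma det_word_mx b s : \det (word_mx b s) = 1.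
Proof.
elim: s b => [|a s IH] b /=; first by rewrite det1.
by rewrite det_mulmx IH mulr1; case: b; rewrite /gen_mx det_mx2; ring.
Qed.

Lemma word_mx_rcons b s a : word_mx b (rcons s a) = word_mx b s *m gen_mx (b (+) odd (size s)) a.
Proof.
elim: s b => [|c s IH] b /=; first by rewrite mulmx1 mul1mx addbF.
by rewrite IH mulmxA addNb -addbN.
Qed.

Lemma word_mx_rowsT s : pos s -> s != [::] ->
  word_mx true s 1 0 <= word_mx true s 0 0 /\ word_mx true s 1 1 <= word_mx true s 0 1.
Proof.
case: s => [//|a s] /= /andP[a0 _] _; have /and4P[h1 h2 h3 h4] := ge0mx_word_mx false s.
by rewrite !mulmx22 !mx2E; split; nia.
Qed.

Lemma word_mx_rowsF s : pos s -> s != [::] ->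
  word_mx false s 0 0 <= word_mx false s 1 0 /\ word_mx false s 0 1 <= word_mx false s 1 1.
Proof.
case: s => [//|a s] /= /andP[a0 _] _; have /and4P[h1 h2 h3 h4] := ge0mx_word_mx true s.
by rewrite !mulmx22 !mx2E; split; nia.
Qed.

(** The first generator is the one whose row dominates; if each row dominated the other, they would
    be equal and the determinant 0. *)
Lemma word_mx_head b s : pos s -> s != [::] ->
  word_mx b s 1 0 <= word_mx b s 0 0 -> word_mx b s 1 1 <= word_mx b s 0 1 -> b = true.
Proof.
case: b => // ps s0 h1 h2; have [h3 h4] := word_mx_rowsF ps s0.
have := det_word_mx false s; rewrite det22.
have -> : word_mx false s 1 0 = word_mx false s 0 0 by lia.
have -> : word_mx false s 1 1 = word_mx false s 0 1 by lia.
by lia.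
Qed.

Lemma word_mx_last b s a : (0 < a)%N ->
  word_mx b (rcons s a) 0 1 <= word_mx b (rcons s a) 0 0 ->
  word_mx b (rcons s a) 1 1 <= word_mx b (rcons s a) 1 0 -> b (+) odd (size s) = false.
Proof.
move=> a0; rewrite word_mx_rcons; case: (_ (+) _) => //.
have := det_word_mx b s; rewrite det22; have /and4P[] := ge0mx_word_mx b s; move: (word_mx b s) => A h1 h2 h3 h4.
rewrite !mulmx22 !mx2E => dA H1 H2.
have e1 : A 0 0 <= A 0 0 * a%:Z by nia.
have e2 : A 1 0 <= A 1 0 * a%:Z by nia.
have z1 : A 0 1 = 0 by lia.
have z2 : A 1 1 = 0 by lia.
by move: dA; rewrite z1 z2; lia.
Qed.

Lemma word_mx_cons b b' s : pos s -> exists b'' t, [/\ pos t, t != [::] & gen_mx b 1 *m word_mx b' s = word_mx b'' t].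
Proof.
case: s => [|a s] ps; first by exists b, [:: 1%N].
case: (eqVneq b b') => [<-|ne].
  exists b, (a.+1 :: s); split=> //; first by case/andP: ps.
  by rewrite /= mulmxA -gen_mxD.
exists b, [:: 1, a & s]%N; split=> //; rewrite [RHS]/=.
by have -> : ~~ b = b' by case: b b' ne => [] [].
Qed.

(** Euclidean algorithm on the rows: with determinant 1, one row dominates the other unless the
    matrix is 1, and subtracting it splits off a generator and lowers the sum of the entries. *)
Lemma ge0mx_word (A : 'M[int]_2) : \det A = 1 -> ge0mx A -> exists b s, pos s /\ A = word_mx b s.
Proof.
have [n] := ubnP (absz (A 0 0 + A 0 1 + A 1 0 + A 1 1)); elim: n A => // n IH A.
rewrite ltnS => hn dA /and4P[h1 h2 h3 h4].
case: (eqVneq A 1%:M) => [->|A1]; first by exists true, [::].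
have /orP hd : ((A 1 0 <= A 0 0) && (A 1 1 <= A 0 1)) || ((A 0 0 <= A 1 0) && (A 0 1 <= A 1 1)).
  apply: contraR A1; rewrite negb_or !negb_and -!ltNge; rewrite det22 in dA.
  move: (A 0 0) (A 0 1) (A 1 0) (A 1 1) (mx2_eta A) dA h1 h2 h3 h4 => a b c d -> dA h1 h2 h3 h4.
  move=> /andP[/orP H1 /orP H2]; apply/eqP; rewrite mx2_1.
  have : [/\ a = 1, b = 0, c = 0 & d = 1] by case: H1; case: H2 => *; split; nia.
  by case=> -> -> -> ->.
have step b (A' : 'M[int]_2) : \det A' = 1 -> ge0mx A' ->
    (absz (A' 0 0 + A' 0 1 + A' 1 0 + A' 1 1)%R < absz (A 0 0 + A 0 1 + A 1 0 + A 1 1)%R)%N -> A = gen_mx b 1 *m A' ->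
    exists b s, pos s /\ A = word_mx b s.
  move=> d' g' m' ->; have [b' [s [ps ->]]] := IH A' (leq_trans m' hn) d' g'.
  by have [b'' [t [pt _ ->]]] := word_mx_cons b b' ps; exists b'', t.
rewrite det22 in dA; case: hd => /andP[H1 H2].
  apply: (step true (mx2 (A 0 0 - A 1 0) (A 0 1 - A 1 1) (A 1 0) (A 1 1))).
  - by rewrite det_mx2 -dA; ring.
  - by rewrite /ge0mx !mx2E; apply/and4P; split; lia.
  - rewrite !mx2E; have : 0 < A 1 0 + A 1 1 by nia.
    by lia.
  - by rewrite [LHS]mx2_eta /gen_mx mul_mx2; apply: eq_mx22; rewrite !mx2E; ring.
apply: (step false (mx2 (A 0 0) (A 0 1) (A 1 0 - A 0 0) (A 1 1 - A 0 1))).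
- by rewrite det_mx2 -dA; ring.
- by rewrite /ge0mx !mx2E; apply/and4P; split; lia.
- rewrite !mx2E; have : 0 < A 0 0 + A 0 1 by nia.
  by lia.
- by rewrite [LHS]mx2_eta /gen_mx mul_mx2; apply: eq_mx22; rewrite !mx2E; ring.
Qed.

Lemma word_mx_even s : ~~ odd (size s) -> word_mx true s = cont s.
Proof.
have [n] := ubnP (size s); elim: n s => // n IH [|a [|b s]] //=.
rewrite !ltnS negbK => hs o; rewrite IH //; last exact: ltnW.
rewrite !cont_cons !mulmxA; congr (_ *m _); rewrite mul_mx2.
by apply: eq_mx22; rewrite mulmx22 !mxE /=; ring.
Qed.

(** Dominance of the first row means that the word begins with R, dominance of the first column that
    it ends with L; so its length is even. *)
Lemma reduced_cont (A : 'M[int]_2) : \det A = 1 -> ge0mx A -> A 1 0 <= A 0 0 -> A 1 1 <= A 0 1 ->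
  A 0 1 <= A 0 0 -> A 1 1 <= A 1 0 -> exists2 s, good s & A = cont s.
Proof.
move=> d g h1 h2 h3 h4; have [b [s [ps E]]] := ge0mx_word d g; subst A.
case/lastP: s => [|s a] in d g h1 h2 h3 h4 ps *; first by move: h2; rewrite /= mx2_1 !mx2E.
have s0 : rcons s a != [::] by case: s {d g h1 h2 h3 h4 ps}.
have bT := word_mx_head ps s0 h1 h2; subst b.
have /andP[a0 ps'] : (0 < a)%N && pos s by move: ps; rewrite /pos all_rcons.
have := word_mx_last a0 h3 h4 => /= /negbFE o.
have g' : good (rcons s a) by rewrite /good s0 ps size_rcons /= o.
by exists (rcons s a) => //; rewrite word_mx_even // size_rcons /= o.
Qed.

Lemma gen_mx_unit b a : gen_mx b a \in unitmx.
Proof. by rewrite unitmxE; case: b; rewrite /gen_mx det_mx2 ?mul0r ?mulr0 subr0 mulr1 unitr1. Qed.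

Lemma word_mx_neq1 b s : pos s -> s != [::] -> word_mx b s <> 1%:M.
Proof.
move=> ps s0 E; case: b E => E.
  by have [_] := word_mx_rowsT ps s0; rewrite E mx2_1 !mx2E.
by have [] := word_mx_rowsF ps s0; rewrite E mx2_1 !mx2E.
Qed.

Lemma word_mx_start b b' s s' : pos s -> pos s' -> s != [::] -> s' != [::] ->
  word_mx b s = word_mx b' s' -> b = b'.
Proof.
move=> ps ps' s0 s0'; case: b; case: b' => // E.
  have [h1 h2] := word_mx_rowsT ps s0; have := @word_mx_head false _ ps' s0'; rewrite -E.
  by move/(_ h1 h2).
have [h1 h2] := word_mx_rowsT ps' s0'; have := @word_mx_head false _ ps s0; rewrite E.
by move/(_ h1 h2).
Qed.

(** The monoid is free: if the first letters differed, cancelling the smaller one would equate two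
    words that begin with different generators. *)
Lemma word_mx_inj b s s' : pos s -> pos s' -> word_mx b s = word_mx b s' -> s = s'.
Proof.
elim: s s' b => [|a t IH] [|a' t'] b //.
- by move=> _ p /esym/word_mx_neq1 [].
- by move=> p _ /word_mx_neq1 [].
have key x x' y y' c : pos (x :: y) -> pos (x' :: y') -> word_mx c (x :: y) = word_mx c (x' :: y') -> (x' <= x)%N.
  move=> /andP[_ py] /= /andP[px' py'] E; rewrite leqNgt; apply/negP => h.
  have E2 : word_mx (~~ c) y = word_mx c ((x' - x)%N :: y').
    apply: (can_inj (mulKmx (gen_mx_unit c x))); rewrite [LHS]E /=.
    by rewrite mulmxA -gen_mxD subnKC // ltnW.
  have pp : pos ((x' - x)%N :: y') by rewrite /= subn_gt0 h.
  case: y => [|z y] in py E E2 *; first by case: (@word_mx_neq1 c _ pp).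
  by have := @word_mx_start _ _ (z :: y) _ py pp isT isT E2; case: c {E E2}.
move=> p p' E; have ea : a = a' by apply/eqP; rewrite eqn_leq (key _ _ _ _ _ p p' E) (key _ _ _ _ _ p' p (esym E)).
subst a'; congr (_ :: _); move: p p' E => /= /andP[_ p] /andP[_ p'] /(can_inj (mulKmx (gen_mx_unit _ _))).
exact: IH.
Qed.

Lemma cont_inj s s' : pos s -> pos s' -> ~~ odd (size s) -> ~~ odd (size s') ->
  cont s = cont s' -> s = s'.
Proof. by move=> p p' o o'; rewrite -!word_mx_even //; apply: word_mx_inj. Qed.

(** * Conjugacy in SL2(Z) *)

Section Conjugacy.
Implicit Types (A g h x y : 'M[int]_2) (s w : seq nat).

Definition gt0mx A := [&& 0 < A 0 0, 0 < A 0 1, 0 < A 1 0 & 0 < A 1 1].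

Definition onesign (p q : int) := ((0 <= p) && (0 <= q)) || ((p <= 0) && (q <= 0)).

Lemma onesign_row g y i : gt0mx g -> onesign (y i 0) (y i 1) ->
  onesign ((y *m g) i 0) ((y *m g) i 1).
Proof.
rewrite /onesign !mulmx22 => /and4P[h1 h2 h3 h4] /orP[] /andP[h5 h6]; apply/orP; [left|right].
  by apply/andP; split; nia.
by apply/andP; split; nia.
Qed.

Lemma expS_mul g n : g ^+ n.+1 = g *m g ^+ n. Proof. by rewrite exprS mulmxE. Qed.
Lemma expSr_mul g n : g ^+ n.+1 = g ^+ n *m g. Proof. by rewrite exprSr mulmxE. Qed.

(* A row with entries of opposite signs shrinks under multiplication by [g]. *)
Lemma row_cone g x i : gt0mx g -> \det g = 1 ->
  exists N, forall n, (N <= n)%N -> onesign ((x *m g ^+ n) i 0) ((x *m g ^+ n) i 1).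
Proof.
move=> g0 dg; have [k] := ubnP (absz (x i 0) + absz (x i 1)); elim: k x => // k IH x.
rewrite ltnS => hk.
have stay y : onesign (y i 0) (y i 1) -> forall n, onesign ((y *m g ^+ n) i 0) ((y *m g ^+ n) i 1).
  move=> hy; elim=> [|n hn]; first by rewrite expr0 mulmx1.
  by rewrite expSr_mul mulmxA; apply: onesign_row.
case: (boolP (onesign (x i 0) (x i 1))) => hx; first by exists 0%N => n _; apply: stay.
suff [N HN] : exists N, forall n, (N <= n)%N ->
    onesign ((x *m g *m g ^+ n) i 0) ((x *m g *m g ^+ n) i 1).
  by exists N.+1 => -[//|n] hn; rewrite expS_mul mulmxA; apply: HN.
case: (boolP (onesign ((x *m g) i 0) ((x *m g) i 1))) => hxg.
  by exists 0%N => n _; apply: stay.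
apply: IH; apply: leq_trans hk; move: hx hxg; rewrite det22 in dg; move: g0; rewrite /gt0mx !mulmx22.
move: (x i 0) (x i 1) (g 0 0) (g 0 1) (g 1 0) (g 1 1) dg => p q a b c d dg /and4P[a0 b0 c0 d0].
rewrite /onesign => hx.
have -> : absz p = absz (d * (p * a + q * c) - c * (p * b + q * d))%R.
  by congr absz; rewrite -[LHS]mul1r -dg; ring.
have -> : absz q = absz (- b * (p * a + q * c) + a * (p * b + q * d))%R.
  by congr absz; rewrite -[LHS]mul1r -dg; ring.
move: (p * a + q * c) (p * b + q * d) => p' q' {hx dg} h.
have [[h1 h2]|[h1 h2]] : (0 < p' /\ q' < 0) \/ (p' < 0 /\ 0 < q').
  by move: h; case: (ltrgtP p' 0); case: (ltrgtP q' 0) => //=; auto.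
- have e1 : p' <= d * p' by nia.
  have e2 : q' * a <= q' by nia.
  have e3 : c * q' < 0 by nia.
  have e4 : 0 < b * p' by nia.
  lia.
- have e1 : d * p' <= p' by nia.
  have e2 : q' <= q' * a by nia.
  have e3 : 0 < c * q' by nia.
  have e4 : b * p' < 0 by nia.
  lia.
Qed.

Lemma col_cone h x j : gt0mx h -> \det h = 1 ->
  exists N, forall n, (N <= n)%N -> onesign ((h ^+ n *m x) 0 j) ((h ^+ n *m x) 1 j).
Proof.
move=> h0 dh; have [||N HN] := @row_cone h^T x^T j.
- by move: h0; rewrite /gt0mx !mxE => /and4P[-> -> -> ->].
- by rewrite det_tr.
exists N => n /HN; have -> : x^T *m h^T ^+ n = (h ^+ n *m x)^T.
  rewrite trmx_mul; congr (_ *m _); elim: n => [|n IH]; first by rewrite !expr0 trmx1.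
  by rewrite expS_mul expSr_mul trmx_mul IH.
by rewrite [_^T j 0]mxE [_^T j 1]mxE.
Qed.

Lemma intertwine_exp g h x n : x *m g = h *m x -> x *m g ^+ n = h ^+ n *m x.
Proof.
move=> E; elim: n => [|n IH]; first by rewrite !expr0 mulmx1 mul1mx.
by rewrite !expSr_mul mulmxA IH -!mulmxA E.
Qed.

Lemma det_exp g n : \det g = 1 -> \det (g ^+ n) = 1.
Proof. by move=> dg; elim: n => [|n IH]; rewrite ?expr0 ?det1 // expS_mul det_mulmx dg IH. Qed.

Lemma comb_gt0 (p q a c : int) : 0 <= p -> 0 <= q -> (p != 0) || (q != 0) -> 0 < a -> 0 < c ->
  0 < p * a + q * c.
Proof.
move=> p0 q0 /orP[h|h] a0 c0.
  by apply: ltr_wpDr; rewrite ?mulr_ge0 ?(ltW c0) // mulr_gt0 // lt_neqAle eq_sym h.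
by apply: ltr_wpDl; rewrite ?mulr_ge0 ?(ltW a0) // mulr_gt0 // lt_neqAle eq_sym h.
Qed.

Lemma comb_lt0 (p q a c : int) : p <= 0 -> q <= 0 -> (p != 0) || (q != 0) -> 0 < a -> 0 < c ->
  p * a + q * c < 0.
Proof.
move=> p0 q0 h a0 c0; have := @comb_gt0 (- p) (- q) a c.
by rewrite !oppr_ge0 !oppr_eq0 => /(_ p0 q0 h a0 c0); lia.
Qed.

(** Multiplication by powers of [g] brings each row to one sign. Since [x *m g ^+ n] equals
    [h ^+ n *m x], the columns have one sign too, so the signs of the two rows agree. *)
Lemma intertwine_sign g h x : gt0mx g -> \det g = 1 -> gt0mx h -> \det h = 1 -> \det x = 1 ->
  x *m g = h *m x -> exists N, ge0mx (x *m g ^+ N) \/ ge0mx (- (x *m g ^+ N)).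
Proof.
move=> g0 dg h0 dh dx E.
have [N0 H0] := row_cone x 0 g0 dg; have [N1 H1] := row_cone x 1 g0 dg.
have [M0 K0] := col_cone x 0 h0 dh; have [M1 K1] := col_cone x 1 h0 dh.
pose N := (N0 + N1 + M0 + M1)%N; exists N.
have r0 : onesign _ _ := H0 N ltac:(lia); have r1 : onesign _ _ := H1 N ltac:(lia).
(* The columns are taken one power later than the rows: the extra factor [g] turns a nonzero row of
   weak sign into one of strict sign. *)
have c0 : onesign _ _ := K0 N.+1 ltac:(lia); have c1 : onesign _ _ := K1 N.+1 ltac:(lia).
rewrite -!(intertwine_exp _ E) expSr_mul mulmxA in c0 c1.
have : \det (x *m g ^+ N) = 1 by rewrite det_mulmx dx det_exp.
move: (x *m g ^+ N) r0 r1 c0 c1 => y; rewrite /onesign !mulmx22 det22.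
have /and4P[a0 b0 e0 d0] := g0.
move=> r0 r1 c0 c1 dy.
have n0 : (y 0 0 != 0) || (y 0 1 != 0).
  by apply: contraTT isT; rewrite negb_or !negbK => /andP[/eqP z0 /eqP z1]; rewrite z0 z1 in dy; lia.
have n1 : (y 1 0 != 0) || (y 1 1 != 0).
  by apply: contraTT isT; rewrite negb_or !negbK => /andP[/eqP z0 /eqP z1]; rewrite z0 z1 in dy; lia.
case/orP: r0 => /andP[p1 q1]; case/orP: r1 => /andP[p2 q2].
- by left; apply/and4P.
- exfalso; have u1 := comb_gt0 p1 q1 n0 a0 e0; have u2 := comb_lt0 p2 q2 n1 a0 e0.
  by case/orP: c0 => /andP[v1 v2]; [rewrite leNgt u2 in v2|rewrite leNgt u1 in v1].
- exfalso; have u1 := comb_lt0 p1 q1 n0 a0 e0; have u2 := comb_gt0 p2 q2 n1 a0 e0.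
  by case/orP: c0 => /andP[v1 v2]; [rewrite leNgt u1 in v1|rewrite leNgt u2 in v2].
- by right; apply/and4P; rewrite !mxE !oppr_ge0.
Qed.

Lemma gt0mx_cont s : good s -> gt0mx (cont s).
Proof.
case: s => [//|a r] g; have [a0 pr o] := good_tail g; have [h1 h2 h3 h4 h5] := tail_facts pr o.
have [_ _ _ h6] := cont_ge0 r.
by rewrite /gt0mx !contE; apply/and4P; split=> //; nia.
Qed.

Lemma det_cont_good s : good s -> \det (cont s) = 1.
Proof. by case/and3P => _ o _; rewrite det_cont -signr_odd (negPf o). Qed.

Lemma good_cont_rows s : good s -> cont s 1 0 <= cont s 0 0 /\ cont s 1 1 <= cont s 0 1.
Proof. by case/and3P => s0 _ p; apply: cont_le_rows. Qed.

Lemma good_cont_cols s : good s -> cont s 0 1 <= cont s 0 0 /\ cont s 1 1 <= cont s 1 0.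
Proof. by case/and3P => s0 _ p; apply: cont_le_cols. Qed.

Lemma good_cat s w : good s -> good w -> good (s ++ w).
Proof.
case/and3P=> s0 o p /and3P[_ o' p']; rewrite /good size_cat oddD (negPf o) (negPf o') /pos all_cat.
by rewrite -/(pos s) -/(pos w) p p'; case: s s0 {o p}.
Qed.

Lemma cont_good_inj s w : good s -> good w -> cont s = cont w -> s = w.
Proof. by move=> /and3P[_ o p] /and3P[_ o' p']; apply: cont_inj. Qed.

(* The intertwiner [x] may be replaced by [x g^N], which is a positive word up
   to sign; conjugacy becomes an equation in a free monoid. *)
Lemma conj_word s s' x : good s -> good s' -> \det x = 1 -> x *m cont s = cont s' *m x ->
  exists w N (e : bool), [/\ good w, x *m cont s ^+ N = (-1) ^+ e *: cont w & w ++ s = s' ++ w].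
Proof.
move=> gs gs' dx E.
have [N HN] := intertwine_sign (gt0mx_cont gs) (det_cont_good gs) (gt0mx_cont gs') (det_cont_good gs') dx E.
have [e He] : exists e : bool, ge0mx ((-1) ^+ e *: (x *m cont s ^+ N)).
  by case: HN => H; [exists false; rewrite expr0 scale1r|exists true; rewrite expr1 scaleN1r].
have sg : (-1) ^+ e * (-1) ^+ e = 1 :> int by rewrite -signr_addb addbb.
(* The factors [cont s'] and [cont s] around [z] make its first row and first column dominant, as
   [reduced_cont] requires. *)
pose z := (-1) ^+ e *: (x *m cont s ^+ N); pose y := cont s' *m z *m cont s.
have dz : \det z = 1.
  by rewrite detZ det_mulmx dx det_exp ?det_cont_good // expr2 sg !mulr1.
have yE : y = (-1) ^+ e *: (x *m cont s ^+ N.+2).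
  rewrite /y /z -scalemxAr -scalemxAl mulmxA -E -!mulmxA; congr (_ *: (_ *m _)).
  by rewrite expSr_mul expS_mul mulmxA.
have dy : \det y = 1 by rewrite !det_mulmx dz !det_cont_good.
have gy : ge0mx y by exact: ge0mx_mul (ge0mx_mul (ge0mx_cont s') He) (ge0mx_cont s).
have [r1 r2] := good_cont_rows gs'; have [c1 c2] := good_cont_cols gs.
have rows A : ge0mx A -> (cont s' *m A) 1 0 <= (cont s' *m A) 0 0 /\ (cont s' *m A) 1 1 <= (cont s' *m A) 0 1.
  by move=> /and4P[a1 a2 a3 a4]; rewrite !mulmx22; split; apply: lerD; apply: ler_wpM2r.
have cols A : ge0mx A -> (A *m cont s) 0 1 <= (A *m cont s) 0 0 /\ (A *m cont s) 1 1 <= (A *m cont s) 1 0.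
  by move=> /and4P[a1 a2 a3 a4]; rewrite !mulmx22; split; apply: lerD; apply: ler_wpM2l.
have [R1 R2] := rows (z *m cont s) (ge0mx_mul He (ge0mx_cont s)).
have [C1 C2] := cols (cont s' *m z) (ge0mx_mul (ge0mx_cont s') He).
rewrite mulmxA in R1 R2; have [w gw wE] := reduced_cont dy gy R1 R2 C1 C2.
exists w, N.+2, e; split=> //; first by rewrite -wE yE scalerA sg scale1r.
apply: cont_good_inj; rewrite ?good_cat // !cont_cat -wE yE -scalemxAl -scalemxAr; congr (_ *: _).
by rewrite -mulmxA -expSr_mul expS_mul !mulmxA E.
Qed.

(** Copies of [s'] are stripped from the front of [w] until the rest is shorter than [s']; that rest
    is the prefix by which [s'] is rotated. *)
Lemma conj_word_rot s s' w : s' != [::] -> ~~ odd (size s') -> ~~ odd (size w) -> w ++ s = s' ++ w ->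
  exists2 i, ~~ odd i && (i <= size s')%N & s = rot i s'.
Proof.
move=> s0 o'; have [n] := ubnP (size w); elim: n w => // n IH w; rewrite ltnS => hn o E.
case: (leqP (size s') (size w)) => h; last first.
  have et : w = take (size w) s'.
    by have := congr1 (take (size w)) E; rewrite take_size_cat // takel_cat // ltnW.
  have es : s' = w ++ drop (size w) s' by rewrite {1}et cat_take_drop.
  exists (size w); first by rewrite o ltnW.
  move: E; rewrite /rot {1}es -catA => /eqP; rewrite eqseq_cat // eqxx => /eqP ->.
  by rewrite -et.
have ew : w = s' ++ drop (size s') w.
  have := congr1 (take (size s')) E; rewrite [RHS]take_size_cat // takel_cat // => e.
  by rewrite -{1}e cat_take_drop.
apply: (IH (drop (size s') w)).
- by rewrite size_drop; move: s0 h hn; rewrite -size_eq0; case: (size s') => // a; case: (size w) => // b; rewrite !ltnS => _ h hn; lia.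
- by rewrite size_drop oddB // (negPf o) (negPf o').
- by move: E; rewrite {1 2}ew -catA => /eqP; rewrite eqseq_cat // eqxx => /eqP.
Qed.

Lemma aperiodic_commute s w : s != [::] -> ~~ periodic s -> ~~ odd (size s) -> ~~ odd (size w) ->
  w ++ s = s ++ w -> exists m, w = flatten (nseq m s).
Proof.
move=> s0 ap os; have [n] := ubnP (size w); elim: n w => // n IH w; rewrite ltnS => hn o E.
case: (leqP (size s) (size w)) => h; last first.
  case: (posnP (size w)) => [/size0nil->|w0]; first by exists 0%N.
  case/negP: ap; apply/periodicP; exists (size w); first by rewrite w0 h.
  have et : w = take (size w) s.
    by have := congr1 (take (size w)) E; rewrite take_size_cat // takel_cat // ltnW.
  have es : s = w ++ drop (size w) s by rewrite {1}et cat_take_drop.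
  move: E; rewrite {2}es -catA => /eqP; rewrite eqseq_cat // eqxx => /eqP E.
  by rewrite /rot -et -E.
have ew : w = s ++ drop (size s) w.
  have := congr1 (take (size s)) E; rewrite [RHS]take_size_cat // takel_cat // => e.
  by rewrite -{1}e cat_take_drop.
have [||| m hm] := IH (drop (size s) w).
- by rewrite size_drop; move: s0 h hn; rewrite -size_eq0; case: (size s) => // a; case: (size w) => // b; rewrite !ltnS => _ h hn; lia.
- by rewrite size_drop oddB // (negPf o) (negPf os).
- by move: E; rewrite {1 2}ew -catA => /eqP; rewrite eqseq_cat // eqxx => /eqP.
by exists m.+1; rewrite /= -hm.
Qed.

Lemma conj_cont s s' x : good s -> good s' -> \det x = 1 -> x *m cont s = cont s' *m x ->
  exists2 i, ~~ odd i && (i <= size s')%N & s = rot i s'.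
Proof.
move=> gs gs' dx E; have [w [N [e [gw _ hw]]]] := conj_word gs gs' dx E.
by apply: conj_word_rot hw; [case/and3P: gs'|case/and3P: gs'|case/and3P: gw].
Qed.

Lemma cont_rot_conj s i : ~~ odd i -> (i <= size s)%N ->
  \det (cont (take i s)) = 1 /\ cont (take i s) *m cont (rot i s) = cont s *m cont (take i s).
Proof.
move=> oi hi; rewrite det_cont size_takel // -signr_odd (negPf oi); split=> //.
by rewrite -{3}(cat_take_drop i s) /rot !cont_cat !mulmxA.
Qed.

Lemma cont_flatten n s : cont (flatten (nseq n s)) = cont s ^+ n.
Proof. by elim: n => [//|n IH]; rewrite /= cont_cat IH expS_mul. Qed.

Lemma pos_flatten n s : pos s -> pos (flatten (nseq n s)).
Proof. by move=> p; elim: n => // n IH; rewrite /pos /= all_cat; apply/andP. Qed.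

(** [y] commutes with [cont s], so some [y *m cont s ^+ N] is, up to sign, a power [cont s ^+ m] by
    aperiodicity. Taking n-th powers and comparing lengths gives N n + 1 = m n, so n divides 1; the
    opposite sign is excluded by positivity. *)
Lemma root_cont s y n (e : bool) : good s -> ~~ periodic s -> \det y = 1 -> (0 < n)%N ->
  y ^+ n = (-1) ^+ e *: cont s -> n = 1%N.
Proof.
move=> gs ap dy n0 E.
have sg (b : bool) : (-1) ^+ b * (-1) ^+ b = 1 :> int by rewrite -signr_addb addbb.
have cs : cont s = (-1) ^+ e *: y ^+ n by rewrite E scalerA sg scale1r.
have com : y *m cont s = cont s *m y.
  by rewrite cs -scalemxAr -scalemxAl; congr (_ *: _); rewrite -expS_mul expSr_mul.
have [w [N [f [gw wE hw]]]] := conj_word gs gs dy com.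
have [s0 os ps] := and3P gs; have [_ ow _] := and3P gw.
have [m hm] := aperiodic_commute s0 ap os ow hw.
have com' : GRing.comm y (cont s ^+ N) by apply: commrX; rewrite /GRing.comm -!mulmxE.
have key : cont s ^+ (N * n).+1 = (-1) ^+ (e (+) (f && odd n)) *: cont s ^+ (m * n).
  have H : (-1) ^+ e *: cont s ^+ (N * n).+1 = (-1) ^+ (f * n)%N *: cont s ^+ (m * n).
    have := congr1 (fun A => A ^+ n) wE.
    by rewrite mulmxE exprMn_comm // E hm cont_flatten exprZn -!exprM -scalerAl -exprS.
  have sf : (-1) ^+ (f && odd n) = (-1) ^+ (f * n)%N :> int.
    by rewrite -[RHS]signr_odd oddM; case: (f).
  by rewrite signr_addb sf -scalerA -H scalerA sg scale1r.
move: key; rewrite -!cont_flatten; case: (e (+) _) => key; last first.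
  rewrite expr0 scale1r in key.
  have := congr1 size (cont_inj _ _ _ _ key); rewrite !pos_flatten // !size_flatten /shape !map_nseq !sumn_nseq.
  rewrite !oddM !(negPf os) => /(_ isT isT isT isT) /eqP.
  rewrite eqn_pmul2l ?lt0n ?size_eq0 // => /eqP h.
  have : (n %| 1)%N by rewrite -(dvdn_addr 1 (dvdn_mull N (dvdnn n))) addn1 h dvdn_mull.
  by rewrite dvdn1 => /eqP.
have := cont_gt0 (pos_flatten (N * n).+1 ps); rewrite key expr1 scaleN1r mxE oppr_gt0.
by rewrite ltNge ltW // cont_gt0 // pos_flatten.
Qed.

(** * Reduction of hyperbolic matrices to words *)

Lemma conj_trans (A B C : 'M[int]_2) : (exists2 u, \det u = 1 & u *m A = B *m u) ->
  (exists2 u, \det u = 1 & u *m B = C *m u) -> exists2 u, \det u = 1 & u *m A = C *m u.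
Proof.
move=> [u du hu] [v dv hv]; exists (v *m u); first by rewrite det_mulmx du dv.
by rewrite -mulmxA hu !mulmxA hv.
Qed.

Lemma conj_shift a b c d n : exists2 u, \det u = 1 &
  u *m mx2 a b c d = mx2 (a + n * c) (b + n * (d - a) - n * n * c) c (d - n * c) *m u.
Proof.
exists (mx2 1 n 0 1); first by rewrite det_mx2; ring.
by rewrite !mul_mx2; apply: eq_mx22; rewrite !mx2E; ring.
Qed.

Lemma conj_flip a b c d : exists2 u, \det u = 1 & u *m mx2 a b c d = mx2 d (- c) (- b) a *m u.
Proof.
exists (mx2 0 (-1) 1 0); first by rewrite det_mx2.
by rewrite !mul_mx2; apply: eq_mx22; rewrite !mx2E; ring.
Qed.

(** Reduction of the indefinite binary quadratic form attached to the matrix, of discriminant t^2 -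
    4 with t the trace, by translations and inversion. *)
Lemma conj_positive a b c d : a * d - b * c = 1 -> 2 < a + d ->
  exists2 A', gt0mx A' /\ \det A' = 1 & exists2 u, \det u = 1 & u *m mx2 a b c d = A' *m u.
Proof.
have [n] := ubnP (absz c); elim: n a b c d => // n IH a b c d; rewrite ltnS => hn dA tA.
have c0 : c != 0.
  apply/eqP => c0; move: dA; rewrite c0 mulr0 subr0 => ad.
  have [a0 d0] : 0 < a /\ 0 < d by split; nia.
  by nia.
have shift k := conj_shift a b c d k.
have dsh k : (a + k * c) * (d - k * c) - (b + k * (d - a) - k * k * c) * c = 1 by rewrite -dA; ring.
case: (ltrP `|c| (a + d)) => hc.
  (* A translation brings [a] into the range from 1 to |c|. Both diagonal entries are then positive
     with sum at least 3, so their product exceeds 1 and [b' * c] is positive; if both are negative,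
     [conj_flip] changes their signs. *)
  pose k := - ((a - 1) %/ c)%Z; have := dsh k; have := shift k.
  have -> : a + k * c = 1 + ((a - 1) %% c)%Z by have := divz_eq (a - 1) c; rewrite /k; lia.
  have -> : d - k * c = (a + d) - (1 + ((a - 1) %% c)%Z) by have := divz_eq (a - 1) c; rewrite /k; lia.
  have := modz_ge0 (a - 1) c0; have := ltz_mod (a - 1) c0.
  move: ((a - 1) %% c)%Z (_ - _ * c) => r b' h1 h2 sh ds.
  have bc : 0 < b' * c by nia.
  case: (ltrP 0 c) => cp.
    have bp : 0 < b' by nia.
    exists (mx2 (1 + r) b' c (a + d - (1 + r))) => //.
    by split; [rewrite /gt0mx !mx2E; apply/and4P; split; lia|rewrite det_mx2].
  have cn : c < 0 by rewrite lt_neqAle c0.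
  have bn : b' < 0 by nia.
  exists (mx2 (a + d - (1 + r)) (- c) (- b') (1 + r)); last exact: conj_trans sh (conj_flip _ _ _ _).
  split; first by rewrite /gt0mx !mx2E; apply/and4P; split; lia.
  by rewrite det_mx2 -[RHS]ds; ring.
(* Here [a] is centred, so that 2a - t is at most |c| in absolute value; then |b'| < |c|, and the
   inversion makes [b'] the new lower left entry. *)
pose lo := ((a + d - `|c| + 1) %/ 2)%Z; pose k := - ((a - lo) %/ c)%Z; have := dsh k; have := shift k.
have -> : a + k * c = lo + ((a - lo) %% c)%Z by have := divz_eq (a - lo) c; rewrite /k; lia.
have -> : d - k * c = (a + d) - (lo + ((a - lo) %% c)%Z) by have := divz_eq (a - lo) c; rewrite /k; lia.
have := modz_ge0 (a - lo) c0; have := ltz_mod (a - lo) c0.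
have : 2 * lo <= a + d - `|c| + 1 /\ a + d - `|c| <= 2 * lo by rewrite /lo; lia.
move: (lo) ((a - lo) %% c)%Z (_ - _ * c) => l r b' [l1 l2] h1 h2 sh ds.
have e : 4 * (b' * c) = (a + d) ^+ 2 - 4 - (2 * (l + r) - (a + d)) ^+ 2.
  have -> : b' * c = (l + r) * (a + d - (l + r)) - 1 by rewrite -[X in _ = _ - X]ds; ring.
  by ring.
have q1 : (2 * (l + r) - (a + d)) ^+ 2 <= `|c| ^+ 2.
  by rewrite -[leLHS]real_normK ?num_real // lerXn2r ?nnegrE //; lia.
have q2 : (a + d) ^+ 2 <= `|c| ^+ 2 by rewrite lerXn2r ?nnegrE //; lia.
have q3 : 4 < (a + d) ^+ 2.
  by rewrite (_ : 4 = 2 ^+ 2) // ltrXn2r ?nnegrE //; lia.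
have bc : `|b'| * `|c| < `|c| * `|c|.
  rewrite -normrM; move: q1 q2 q3; rewrite -expr2; have := sqr_ge0 (2 * (l + r) - (a + d)).
  by lia.
have bl : `|b'| < `|c| by move: bc; rewrite ltr_pM2r // normr_gt0.
have [A' hA' cA'] := IH (a + d - (l + r)) (- c) (- b') (l + r) ltac:(lia) ltac:(rewrite -ds; ring) ltac:(lia).
exists A' => //; apply: conj_trans cA'; apply: conj_trans sh _; exact: conj_flip.
Qed.

(** In a word of odd length the first and last letters belong to the same generator and are merged
    by conjugation; a word of even length that begins with L is rotated by one letter. *)
Lemma positive_cont A : gt0mx A -> \det A = 1 ->
  exists2 s, good s & exists2 u, \det u = 1 & u *m A = cont s *m u.
Proof.
move=> gA dA; have gA' : ge0mx A by case/and4P: gA => *; apply/and4P; split; apply: ltW.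
have even b s : pos s -> s != [::] -> ~~ odd (size s) ->
    exists2 s', good s' & exists2 u, \det u = 1 & u *m word_mx b s = cont s' *m u.
  case: b => ps s0 o.
    exists s; first by rewrite /good s0 o ps.
    by exists 1%:M; rewrite ?det1 // mul1mx mulmx1 word_mx_even.
  case: s ps s0 o => [//|a t] /= /andP[a0 pt] _; rewrite negbK => o.
  exists (rcons t a).
    by rewrite /good -size_eq0 size_rcons /= o /pos all_rcons /= a0.
  exists (word_mx true t); first exact: det_word_mx.
  rewrite -(word_mx_even (s := rcons t a)) ?size_rcons /= ?o //.
  by rewrite word_mx_rcons o mulmxA.
have [b [s [ps E]]] := ge0mx_word dA gA'; subst A.
case: s ps gA {dA gA'} => [|a t] ps gA; first by move: gA; rewrite /= mx2_1 /gt0mx !mx2E.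
case: (boolP (odd (size (a :: t)))) => o; last exact: even.
case/lastP: t => [|t c] in ps gA o *.
  by move: gA; rewrite /= mulmx1 /gt0mx; case: (b); rewrite /gen_mx !mx2E => /and4P[].
have ot : odd (size t) by move: o; rewrite /= size_rcons /= negbK.
have /and3P[a0 c0 pt] : [&& (0 < a)%N, (0 < c)%N & pos t] by move: ps; rewrite /pos /= all_rcons.
have [||| s' gs' cs'] := even b ((c + a)%N :: t) => //; first by rewrite /= addn_gt0 c0.
  by rewrite /= negbK.
exists s' => //; apply: conj_trans cs'; exists (gen_mx b c).
  by case: (b); rewrite /gen_mx det_mx2; ring.
rewrite [word_mx b (a :: _)]/= word_mx_rcons ot addbT negbK [word_mx b (_ :: t)]/= gen_mxD.
by rewrite !mulmxA.
Qed.

Lemma hyperbolic_cont A : \det A = 1 -> 2 < \tr A ->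
  exists2 s, good s & exists2 u, \det u = 1 & u *m A = cont s *m u.
Proof.
rewrite det22 mxtrace22 => dA tA.
have [A' [gA' dA'] cA'] := conj_positive dA tA; rewrite -mx2_eta in cA'.
have [s gs cs] := positive_cont gA' dA'; exists s => //; exact: conj_trans cA' cs.
Qed.

End Conjugacy.

(** * Complex logarithms *)

Section Log.
Local Open Scope complex_scope.
Variable R : realType.
Local Notation C := R[i].
Local Notation Re := (@complex.Re R).
Local Notation Im := (@complex.Im R).
Implicit Types (z w u : C).

Lemma eq_ReIm z w : Re z = Re w -> Im z = Im w -> z = w.
Proof. by case: z => a b; case: w => c d /= -> ->. Qed.

Lemma ReMc z w : Re (z * w) = Re z * Re w - Im z * Im w.
Proof. by case: z => a b; case: w => c d. Qed.
Lemma ImMc z w : Im (z * w) = Re z * Im w + Im z * Re w.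
Proof. by case: z => a b; case: w => c d. Qed.
Lemma ReDc z w : Re (z + w) = Re z + Re w.
Proof. by case: z => a b; case: w => c d. Qed.
Lemma ImDc z w : Im (z + w) = Im z + Im w.
Proof. by case: z => a b; case: w => c d. Qed.
Lemma ReNc z : Re (- z) = - Re z.
Proof. by case: z. Qed.
Lemma ImNc z : Im (- z) = - Im z.
Proof. by case: z. Qed.
Definition ReImcE := (ReMc, ImMc, ReDc, ImDc, ReNc, ImNc).

Lemma Re_intc (k : int) : Re k%:~R = k%:~R.
Proof. by rewrite -(rmorph_int (real_complex R)). Qed.
Lemma Im_intc (k : int) : Im k%:~R = 0.
Proof. by rewrite -(rmorph_int (real_complex R)). Qed.

Lemma Re_cexp z : Re (cexp z) = expR (Re z) * cos (Im z).
Proof. by rewrite /cexp ReMc /= mul0r subr0. Qed.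
Lemma Im_cexp z : Im (cexp z) = expR (Re z) * sin (Im z).
Proof. by rewrite /cexp ImMc /= mul0r addr0. Qed.

Lemma cexpD z w : cexp (z + w) = cexp z * cexp w.
Proof.
case: z => a b; case: w => c d; apply: eq_ReIm.
  by rewrite [RHS]ReMc !Re_cexp !Im_cexp /= expRD cosD; ring.
by rewrite [RHS]ImMc !Re_cexp !Im_cexp /= expRD sinD; ring.
Qed.

Lemma cexp0 : cexp (0 : C) = 1.
Proof. by apply: eq_ReIm; rewrite ?Re_cexp ?Im_cexp /= expR0 ?cos0 ?sin0 mul1r. Qed.

Lemma cos_eq1 (x : R) : `|x| < 2 * pi -> cos x = 1 -> x = 0.
Proof.
move=> hx c1; apply/eqP; apply: contraT => x0.
have n0 : 0 < `|x| by rewrite normr_gt0.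
pose y := `|x| / 2; have hy : y *+ 2 = `|x| by rewrite /y mulr2n; lra.
have cx : cos (y *+ 2) = 1 by rewrite hy -c1; case: (ger0P x) => // _; rewrite cosN.
have s0 : 0 < sin y by apply: sin_gt0_pi; apply/andP; split; rewrite /y; lra.
have s2 : 0 < sin y ^+ 2 by rewrite exprn_gt0.
by move: cx; rewrite cos_mulr2n cos2sin2 mulr2n; lra.
Qed.

Lemma cexp_inj z w : `|Im z - Im w| < 2 * pi -> cexp z = cexp w -> z = w.
Proof.
move=> h E.
have e1 : expR (Re z) * cos (Im z) = expR (Re w) * cos (Im w) by rewrite -!Re_cexp E.
have e2 : expR (Re z) * sin (Im z) = expR (Re w) * sin (Im w) by rewrite -!Im_cexp E.
have e3 : expR (Re z) ^+ 2 = expR (Re w) ^+ 2.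
  transitivity ((expR (Re z) * cos (Im z)) ^+ 2 + (expR (Re z) * sin (Im z)) ^+ 2).
    by rewrite !exprMn -mulrDr cos2Dsin2 mulr1.
  by rewrite e1 e2 !exprMn -mulrDr cos2Dsin2 mulr1.
have e4 : expR (Re z) = expR (Re w).
  by apply/eqP; move/eqP: e3; rewrite eqrXn2 ?expR_ge0.
have p : expR (Re w) != 0 by rewrite gt_eqF ?expR_gt0.
have e5 : cos (Im z) = cos (Im w) by apply: (mulfI p); rewrite -{1}e4.
have e6 : sin (Im z) = sin (Im w) by apply: (mulfI p); rewrite -{1}e4.
apply: eq_ReIm; first exact: expR_inj.
apply/eqP; rewrite -subr_eq0; apply/eqP; apply: cos_eq1 => //.
by rewrite cosB e5 e6 -!expr2 cos2Dsin2.
Qed.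

Lemma cexp_surj u : 0 < Im u -> exists2 l, cexp l = u & 0 < Im l < pi.
Proof.
move=> u0; pose r := Num.sqrt (Re u ^+ 2 + Im u ^+ 2).
have q0 : 0 < Re u ^+ 2 + Im u ^+ 2 by apply: ltr_wpDl; rewrite ?sqr_ge0 ?exprn_gt0.
have r0 : 0 < r by rewrite sqrtr_gt0.
have r2 : r ^+ 2 = Re u ^+ 2 + Im u ^+ 2 by rewrite sqr_sqrtr // ltW.
have rr : `|Re u| < r.
  rewrite -(@ltr_pXn2r _ 2) ?nnegrE ?normr_ge0 ?ltW // real_normK ?num_real // r2.
  by rewrite ltrDl exprn_gt0.
pose x := Re u / r.
have hx : -1 < x < 1.
  by move: rr; rewrite ltr_norml /x ltr_pdivlMr // ltr_pdivrMr // mulN1r mul1r.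
have hx' : -1 <= x <= 1 by case/andP: hx => h1 h2; rewrite !ltW.
case/andP: hx => h1 h2.
have t0 : 0 < acos x by apply: acos_gt0; rewrite (ltW h1).
have t1 : acos x < pi by apply: acos_ltpi; rewrite (ltW h2) h1.
have cx : cos (acos x) = x by apply: acosK; rewrite in_itv /=.
have sx : sin (acos x) = Im u / r.
  have s0 : 0 < sin (acos x) by apply: sin_gt0_pi; rewrite t0.
  have s1 : 0 < Im u / r by rewrite divr_gt0.
  apply/eqP; rewrite -(@eqrXn2 _ 2) ?ltW // sin2cos2 cx /x !expr_div_n r2.
  by apply/eqP; field; rewrite gt_eqF.
exists (ln r +i* acos x); last by rewrite /= t0.
by apply: eq_ReIm; rewrite ?Re_cexp ?Im_cexp /= lnK ?posrE // ?cx ?sx /x mulrC divfK // gt_eqF.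
Qed.

Lemma clogE z w : cexp w = z -> - pi <= Im w < pi -> clog z = w.
Proof.
move=> e h; apply: xget_unique => //= y [e' h']; apply: cexp_inj; last by rewrite e' e.
by rewrite ltr_norml; lra.
Qed.

Definition pi_i : C := 0 +i* pi.

Lemma cexp_pi : cexp pi_i = -1.
Proof. by apply: eq_ReIm; rewrite ?Re_cexp ?Im_cexp /= expR0 ?cospi ?sinpi mul1r ?oppr0. Qed.

Lemma clog_Nsqr l : 0 < Im l < pi -> clog (- cexp l ^+ 2) = l + l - pi_i.
Proof.
move=> h; apply: clogE; last by rewrite !ReImcE /=; lra.
have E : cexp (l + l) = cexp (l + l - pi_i) * cexp pi_i by rewrite -cexpD subrK.
by rewrite expr2 -cexpD E cexp_pi mulrN1 opprK.
Qed.

Definition Nlog w := clog (- w ^+ 2).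

Lemma NlogN w : Nlog (- w) = Nlog w. Proof. by rewrite /Nlog sqrrN. Qed.

(** By [clog_Nsqr] each [Nlog] is twice a logarithm minus [pi_i]. Here the arguments of [u1] and
    [u2] add up to that of [u3]; in [Nlog_neg] they exceed it by pi. *)
Lemma Nlog_pos u1 u2 u3 : 0 < Im u1 -> 0 < Im u2 -> 0 < Im u3 -> u1 * u2 = u3 ->
  Nlog u1 + Nlog u2 - Nlog u3 = - pi_i.
Proof.
move=> /cexp_surj[l1 <- h1] /cexp_surj[l2 <- h2] /cexp_surj[l3 <- h3] E.
rewrite /Nlog !clog_Nsqr //.
have -> : l3 = l1 + l2; last by rewrite -[RHS]/(- pi_i); ring.
by apply: cexp_inj; rewrite ?cexpD ?E // !ReImcE ltr_norml; lra.
Qed.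

Lemma Nlog_neg u1 u2 u3 : 0 < Im u1 -> 0 < Im u2 -> 0 < Im u3 -> u1 * u2 = - u3 ->
  Nlog u1 + Nlog u2 - Nlog u3 = pi_i.
Proof.
move=> /cexp_surj[l1 <- h1] /cexp_surj[l2 <- h2] /cexp_surj[l3 <- h3] E.
rewrite /Nlog !clog_Nsqr //.
have -> : l3 = l1 + l2 - pi_i; last by ring.
apply/eqP; rewrite eq_sym subr_eq; apply/eqP/esym.
by apply: cexp_inj; rewrite ?cexpD ?E ?cexp_pi ?mulrN1 // !ReImcE ltr_norml /=; lra.
Qed.

(** The arguments add up to a number strictly between 0 and 2 pi; so the product 1 is impossible,
    and -1 means that the sum is pi. *)
Lemma Nlog_real u1 u2 : 0 < Im u1 -> 0 < Im u2 -> u1 * u2 = 1 \/ u1 * u2 = -1 ->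
  Nlog u1 + Nlog u2 = 0.
Proof.
move=> /cexp_surj[l1 <- h1] /cexp_surj[l2 <- h2] [] E.
  have /(congr1 Im) : l1 + l2 = 0.
    by apply: cexp_inj; rewrite ?cexpD ?E ?cexp0 // !ReImcE ltr_norml /=; lra.
  by move=> e; exfalso; move: e; rewrite !ReImcE /=; lra.
rewrite /Nlog !clog_Nsqr //.
have -> : l2 = pi_i - l1; last by ring.
apply/eqP; rewrite eq_sym subr_eq addrC eq_sym; apply/eqP.
by apply: cexp_inj; rewrite ?cexpD ?E ?cexp_pi // !ReImcE ltr_norml /=; lra.
Qed.

End Log.

(** * The Rademacher symbol *)

Lemma entry_det (g : SL2Z) : entry_a g * entry_d g - entry_b g * entry_c g = 1.
Proof. by rewrite /entry_a /entry_b /entry_c /entry_d -det22 SL2Z_det. Qed.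

Lemma entry_mul (g h : SL2Z) :
  [/\ entry_a (g * h)%g = entry_a g * entry_a h + entry_b g * entry_c h,
      entry_b (g * h)%g = entry_a g * entry_b h + entry_b g * entry_d h,
      entry_c (g * h)%g = entry_c g * entry_a h + entry_d g * entry_c h &
      entry_d (g * h)%g = entry_c g * entry_b h + entry_d g * entry_d h].
Proof. by rewrite /entry_a /entry_b /entry_c /entry_d /= !mulmx22. Qed.

Lemma cocycle_algebra (K : comNzRingType) (p q r x y t G A B s c : K) :
  p - r = 6 * y + 2 * G * c -> p - q = 6 * x + 2 * A * c -> q - r = 6 * t + 2 * B * c ->
  x + t - y = - s * c -> 2 * G * c = 2 * (A + B - 3 * s) * c.
Proof.
move=> e1 e2 e3 e4.
have -> : 2 * G * c = (p - r) - 6 * y by rewrite e1; ring.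
have -> : p - r = (p - q) + (q - r) by ring.
have -> : 2 * (A + B - 3 * s) * c = 2 * A * c + 2 * B * c + 6 * (- s * c) by ring.
by rewrite e2 e3 -e4; ring.
Qed.

Section Symbol.
Local Open Scope complex_scope.
Variable R : realType.
Local Notation C := R[i].
Local Notation Re := (@complex.Re R).
Local Notation Im := (@complex.Im R).
Implicit Types (z w u : C) (g h : SL2Z).

Lemma Im_divc z w : Im (z / w) = (Im z * Re w - Re z * Im w) / (Re w ^+ 2 + Im w ^+ 2).
Proof. by case: z => a b; case: w => c d; rewrite ImMc /=; ring. Qed.

Lemma Im_automorphy g z : Im (automorphy g z) = (entry_c g)%:~R * Im z.
Proof. by rewrite /automorphy !ReImcE Re_intc !Im_intc mul0r !addr0. Qed.

Lemma Re_automorphy g z : Re (automorphy g z) = (entry_c g)%:~R * Re z + (entry_d g)%:~R.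
Proof. by rewrite /automorphy !ReImcE !Re_intc !Im_intc mul0r subr0. Qed.

Lemma automorphy_neq0 g z : 0 < Im z -> automorphy g z != 0.
Proof.
move=> z0; apply/eqP => e.
have := congr1 Im e; have := congr1 Re e; rewrite Im_automorphy Re_automorphy /= => h1 /eqP.
rewrite mulf_eq0 (gt_eqF z0) orbF intr_eq0 => /eqP c0; move: h1 (entry_det g).
by rewrite c0 mul0r add0r => /eqP; rewrite intr_eq0 => /eqP ->; lia.
Qed.

Lemma Im_moebius_gt0 g z : 0 < Im z -> 0 < Im (moebius g z).
Proof.
move=> z0; rewrite /moebius Im_divc divr_gt0 //.
  rewrite Im_automorphy Re_automorphy !ReImcE !Re_intc !Im_intc !mul0r subr0 !addr0.
  suff -> : (entry_a g)%:~R * Im z * ((entry_c g)%:~R * Re z + (entry_d g)%:~R)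
    - ((entry_a g)%:~R * Re z + (entry_b g)%:~R) * ((entry_c g)%:~R * Im z) = Im z by [].
  transitivity (((entry_a g * entry_d g - entry_b g * entry_c g)%:~R : R) * Im z); last by rewrite entry_det mul1r.
  by rewrite intrD intrN !intrM; ring.
have := automorphy_neq0 g z0; rewrite lt_neqAle addr_ge0 ?sqr_ge0 // andbT => n0.
rewrite eq_sym paddr_eq0 ?sqr_ge0 // !sqrf_eq0; apply: contra n0 => /andP[/eqP e1 /eqP e2].
by apply/eqP; apply: eq_ReIm.
Qed.

Lemma automorphy_mul g h z : 0 < Im z ->
  automorphy (g * h)%g z = automorphy g (moebius h z) * automorphy h z.
Proof.
move=> z0; have n0 := automorphy_neq0 h z0; have [_ _ e1 e2] := entry_mul g h.
rewrite {2}/automorphy mulrDl -mulrA /moebius divfK // /automorphy e1 e2 !intrD !intrM; ring.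
Qed.

Lemma moebius_mul g h z : 0 < Im z -> moebius (g * h)%g z = moebius g (moebius h z).
Proof.
move=> z0; have n0 := automorphy_neq0 h z0; have n1 := automorphy_neq0 g (Im_moebius_gt0 h z0).
have [e1 e2 _ _] := entry_mul g h.
have E : (entry_a (g * h)%g)%:~R * z + (entry_b (g * h)%g)%:~R =
    (entry_a g)%:~R * ((entry_a h)%:~R * z + (entry_b h)%:~R) + (entry_b g)%:~R * automorphy h z :> C.
  by rewrite e1 e2 /automorphy !intrD !intrM; ring.
have wE : moebius h z = ((entry_a h)%:~R * z + (entry_b h)%:~R) / automorphy h z by [].
rewrite {1}/moebius automorphy_mul // E [moebius g _]/moebius.
move: n0 n1; move: (automorphy g _) => j1 n0 n1; rewrite wE.
by move: (automorphy h z) n0 => j2 n0; field; rewrite n0 n1.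
Qed.

Lemma sgz_unit (c : int) : c != 0 -> (sgz c = 1 \/ sgz c = -1) /\ 0 < sgz c * c.
Proof. by move=> c0; case: (sgzP c) c0 => // h _; split; auto; lia. Qed.

Lemma pm1_mul (a d : int) : a * d = 1 -> a = 1 /\ d = 1 \/ a = -1 /\ d = -1.
Proof.
move=> h; have := congr1 absz h; rewrite abszM => /eqP; rewrite muln_eq1 => /andP[/eqP h1 _].
have [e|e] : a = 1 \/ a = -1 by lia.
  by left; rewrite e in h *; lia.
by right; rewrite e in h *; lia.
Qed.

Lemma Nlog_pm (e : int) w : e = 1 \/ e = -1 -> Nlog (e%:~R * w) = Nlog w.
Proof. by case=> ->; rewrite ?mul1r // mulN1r NlogN. Qed.

Lemma automorphy_c0 g z : entry_c g = 0 -> automorphy g z = (entry_d g)%:~R.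
Proof. by rewrite /automorphy => ->; rewrite mul0r add0r. Qed.

(** [Nlog] is even, so each automorphy factor can be multiplied by the sign of its lower left entry,
    which moves it into the upper half plane. The product of the three signs then decides between
    [Nlog_pos] and [Nlog_neg]. *)
Lemma Nlog_cocycle g h z : 0 < Im z ->
  let w := moebius h z in
  (if entry_c g != 0 then Nlog (automorphy g w) else 0) +
  (if entry_c h != 0 then Nlog (automorphy h z) else 0) -
  (if entry_c (g * h)%g != 0 then Nlog (automorphy (g * h)%g z) else 0) =
  - (sgz (entry_c g * entry_c h * entry_c (g * h)%g))%:~R * pi_i R.
Proof.
move=> z0 w; have w0 : 0 < Im w := Im_moebius_gt0 h z0.
have JE := automorphy_mul g h z0; rewrite -/w in JE.
have [_ _ ec ed] := entry_mul g h; have dg := entry_det g; have dh := entry_det h.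
case: (eqVneq (entry_c g) 0) => [cg|cg] /=.
  rewrite cg !mul0r sgz0 oppr0 mul0r add0r.
  have dg' : entry_d g = 1 \/ entry_d g = -1.
    by move: dg; rewrite cg mulr0 subr0 => /pm1_mul[] [_ ->]; auto.
  rewrite ec cg mul0r add0r JE (automorphy_c0 _ cg) Nlog_pm // mulf_eq0.
  by case: dg' => -> /=; rewrite subrr.
case: (eqVneq (entry_c h) 0) => [ch|ch] /=.
  rewrite ch mulr0 mul0r sgz0 oppr0 mul0r addr0.
  have [ah dh'] : (entry_a h != 0) /\ (entry_d h = 1 \/ entry_d h = -1).
    by move: dh; rewrite ch mulr0 subr0 => /pm1_mul[] [-> ->]; auto.
  rewrite ec ch mulr0 addr0 JE (automorphy_c0 _ ch) [automorphy g w * _]mulrC Nlog_pm // mulf_eq0.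
  by rewrite (negPf cg) (negPf ah) subrr.
have [sg pg] := sgz_unit cg; have [sh ph] := sgz_unit ch.
pose u1 := (sgz (entry_c g))%:~R * automorphy g w.
pose u2 := (sgz (entry_c h))%:~R * automorphy h z.
have im k z' : 0 < Im z' -> 0 < sgz (entry_c k) * entry_c k ->
    0 < Im ((sgz (entry_c k))%:~R * automorphy k z').
  move=> z'0 pk; rewrite ImMc Re_intc Im_intc mul0r addr0 Im_automorphy mulrA -intrM.
  by rewrite mulr_gt0 // ltr0z.
have i1 : 0 < Im u1 by apply: im.
have i2 : 0 < Im u2 by apply: im.
have u12 : u1 * u2 = (sgz (entry_c g) * sgz (entry_c h))%:~R * automorphy (g * h)%g z.
  by rewrite JE intrM /u1 /u2; ring.
have E1 : Nlog (automorphy g w) = Nlog u1 by rewrite Nlog_pm.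
have E2 : Nlog (automorphy h z) = Nlog u2 by rewrite Nlog_pm.
rewrite E1 E2; case: (eqVneq (entry_c (g * h)%g) 0) => [c3|c3] /=.
  rewrite c3 mulr0 sgz0 oppr0 mul0r addr0; apply: Nlog_real => //.
  rewrite u12 (automorphy_c0 _ c3) -intrM.
  have d3 : entry_d (g * h)%g = 1 \/ entry_d (g * h)%g = -1.
    by have := entry_det (g * h)%g; rewrite c3 mulr0 subr0 => /pm1_mul[] [_ ->]; auto.
  have [e|e] : sgz (entry_c g) * sgz (entry_c h) * entry_d (g * h)%g = 1 \/
               sgz (entry_c g) * sgz (entry_c h) * entry_d (g * h)%g = -1.
  - by case: sg => ->; case: sh => ->; case: d3 => ->; auto.
  - by left; rewrite e.
  - by right; rewrite e intrN.
have [s3 p3] := sgz_unit c3; pose u3 := (sgz (entry_c (g * h)%g))%:~R * automorphy (g * h)%g z.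
have i3 : 0 < Im u3 by apply: im.
have E3 : Nlog (automorphy (g * h)%g z) = Nlog u3 by rewrite Nlog_pm.
have J3 : automorphy (g * h)%g z = (sgz (entry_c (g * h)%g))%:~R * u3.
  have ss : sgz (entry_c (g * h)%g) * sgz (entry_c (g * h)%g) = 1 by case: s3 => ->.
  by rewrite /u3 mulrA -intrM ss mul1r.
rewrite E3 !sgzM; rewrite {}J3 mulrA -intrM in u12.
have [e|e] : sgz (entry_c g) * sgz (entry_c h) * sgz (entry_c (g * h)%g) = 1 \/
             sgz (entry_c g) * sgz (entry_c h) * sgz (entry_c (g * h)%g) = -1.
- by case: sg => ->; case: sh => ->; case: s3 => ->; auto.
- by rewrite e mulN1r; apply: Nlog_pos => //; rewrite u12 e mul1r.
- by rewrite e opprK mul1r; apply: Nlog_neg => //; rewrite u12 e mulN1r.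
Qed.

Variable Phi : SL2Z -> int.
Hypothesis HPhi : dedekind_symbol R Phi.

Lemma two_pi_iE : two_pi_i R = 2 * pi_i R.
Proof.
have -> : 2 = (2 : int)%:~R :> C by [].
by apply: eq_ReIm; rewrite ?ReMc ?ImMc Re_intc Im_intc /= ?mul0r ?mulr0 ?addr0 ?subr0.
Qed.

Lemma pi_i_neq0 : pi_i R != 0.
Proof. by apply/eqP => /(congr1 Im) /= /eqP; rewrite gt_eqF ?pi_gt0. Qed.

Lemma Phi_eq g z : 0 < Im z -> log_Delta (moebius g z) - log_Delta z =
  6 * (if entry_c g != 0 then Nlog (automorphy g z) else 0) + 2 * (Phi g)%:~R * pi_i R.
Proof.
move=> z0; rewrite HPhi // two_pi_iE; case: ifP => _; rewrite ?mulr0 /Nlog.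
  by congr (_ + _); ring.
by congr (_ + _); ring.
Qed.

Lemma Im_i : 0 < Im 'i%C. Proof. exact: ltr01. Qed.

(** The chain rule for [moebius], evaluated at z = i. The coefficient 3 is the factor 6 of the
    logarithms divided by the 2 in [two_pi_i]. *)
Lemma Phi_cocycle g h :
  Phi (g * h)%g = Phi g + Phi h - 3 * sgz (entry_c g * entry_c h * entry_c (g * h)%g).
Proof.
have z0 := Im_i; have w0 := Im_moebius_gt0 h z0.
have e1 := Phi_eq (g * h)%g z0; have e2 := Phi_eq g w0; have e3 := Phi_eq h z0.
have := Nlog_cocycle g h z0; rewrite /= moebius_mul // in e1 *.
move: e1 e2 e3; set y := (X in 6 * X + _); set x := (X in _ -> _ = 6 * X + _ -> _).
set t := (X in _ -> _ -> _ = 6 * X + _ -> _); move: (sgz _) => s e1 e2 e3 e4.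
have inj : injective (fun k : int => 2 * k%:~R * pi_i R).
  move=> k k' /(mulIf pi_i_neq0) /(mulfI _) H; apply: (@intr_inj C); apply: H.
  by rewrite pnatr_eq0.
apply: inj; rewrite /= intrB intrD intrM.
exact: cocycle_algebra e1 e2 e3 e4.
Qed.

(** * Values of the Dedekind symbol and conjugacy invariance *)

Definition toSL (A : 'M[int]_2) : SL2Z := insubd SL2Z_one A.

Lemma val_toSL A : \det A = 1 -> SL2Z_mx (toSL A) = A.
Proof. by move=> /eqP d; rewrite -[SL2Z_mx _]/(val (insubd SL2Z_one A)) insubdK. Qed.

Lemma toSL_mul A B : \det A = 1 -> \det B = 1 -> toSL (A *m B) = (toSL A * toSL B)%g.
Proof. by move=> dA dB; apply: val_inj; rewrite /= !val_toSL // det_mulmx dA dB. Qed.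

Definition sR (n : int) := toSL (mx2 1 n 0 1).
Definition sS := toSL (mx2 0 (-1) 1 0).

Lemma sR_mx n : SL2Z_mx (sR n) = mx2 1 n 0 1.
Proof. by rewrite val_toSL // det_mx2 mulr0 mulr1. Qed.
Lemma sS_mx : SL2Z_mx sS = mx2 0 (-1) 1 0.
Proof. by rewrite val_toSL // det_mx2. Qed.

Lemma sR_entry n : [/\ entry_a (sR n) = 1, entry_b (sR n) = n, entry_c (sR n) = 0 & entry_d (sR n) = 1].
Proof. by rewrite /entry_a /entry_b /entry_c /entry_d sR_mx !mx2E. Qed.
Lemma sS_entry : [/\ entry_a sS = 0, entry_b sS = -1, entry_c sS = 1 & entry_d sS = 0].
Proof. by rewrite /entry_a /entry_b /entry_c /entry_d sS_mx !mx2E. Qed.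

Lemma SL2Z_eqP g h : entry_a g = entry_a h -> entry_b g = entry_b h -> entry_c g = entry_c h ->
  entry_d g = entry_d h -> g = h.
Proof. by move=> *; apply: val_inj; apply: eq_mx22. Qed.

Lemma sR_add n k : sR (n + k) = (sR n * sR k)%g.
Proof.
rewrite /sR -toSL_mul ?det_mx2 ?mulr0 ?subr0 ?mulr1 // mul_mx2; congr toSL.
by apply: eq_mx22; rewrite !mx2E; ring.
Qed.

Lemma cexp_2pi : cexp (two_pi_i R) = 1.
Proof. by apply: eq_ReIm; rewrite ?Re_cexp ?Im_cexp /= expR0 mul1r mulr_natl ?cos2pi ?sin2pi. Qed.

(** Translation by 1 leaves [q] unchanged, so the series terms cancel whatever their value, and only
    the linear term of [log_Delta] remains. *)
Lemma Phi_R1 : Phi (sR 1) = 1.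
Proof.
have z0 := Im_i; have := Phi_eq (sR 1) z0; have [ea eb ec ed] := sR_entry 1.
have -> : moebius (sR 1) 'i%C = 'i%C + 1 :> C.
  by rewrite /moebius automorphy_c0 // ea eb ed divr1 mul1r.
rewrite ec eqxx /= mulr0 add0r /log_Delta mulrDr mulr1 cexpD cexp_2pi mulr1.
move: (limn _) => l; rewrite two_pi_iE => e.
have e' : 2 * 1 * pi_i R = 2 * (Phi (sR 1))%:~R * pi_i R.
  by rewrite -e; move: ('i%C) (pi_i R) => x y; ring.
have n2 : 2 != 0 :> C by rewrite pnatr_eq0.
by apply: (@intr_inj C); apply: (mulfI n2); apply: (mulIf pi_i_neq0); rewrite -e'.
Qed.

Lemma Phi_sRl n g : Phi (sR n * g)%g = Phi (sR n) + Phi g.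
Proof. by rewrite Phi_cocycle; have [_ _ -> _] := sR_entry n; rewrite !mul0r sgz0 mulr0 subr0. Qed.

Lemma Phi_sRr n g : Phi (g * sR n)%g = Phi g + Phi (sR n).
Proof. by rewrite Phi_cocycle; have [_ _ -> _] := sR_entry n; rewrite mulr0 mul0r sgz0 mulr0 subr0. Qed.

Lemma Phi_sR n : Phi (sR n) = n.
Proof.
have R0 : Phi (sR 0) = 0 by have := Phi_sRl 0 (sR 0); rewrite -sR_add addr0; lia.
have Rnat (k : nat) : Phi (sR k%:Z) = k%:Z.
  by elim: k => // k IH; rewrite intS sR_add Phi_sRl IH Phi_R1.
case: (intP n) => [|k|k] //.
have := Phi_sRl (- k.+1%:Z) (sR k.+1%:Z); rewrite -sR_add addNr R0 Rnat; lia.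
Qed.

Definition sN := toSL (mx2 (-1) 0 0 (-1)).

Lemma sN_entry : [/\ entry_a sN = -1, entry_b sN = 0, entry_c sN = 0 & entry_d sN = -1].
Proof. by rewrite /entry_a /entry_b /entry_c /entry_d val_toSL ?det_mx2 // !mx2E. Qed.

Lemma Phi_sN : Phi sN = 0.
Proof.
have [ea eb ec ed] := sN_entry; have z0 := Im_i; have := Phi_eq sN z0.
have -> : moebius sN 'i%C = 'i%C :> C.
  by rewrite /moebius automorphy_c0 // ea eb ed !mulrN1z mulN1r addr0 invrN invr1 mulrN1 opprK.
rewrite ec eqxx /= mulr0 add0r subrr => /esym/eqP.
by rewrite mulf_eq0 (negPf pi_i_neq0) orbF mulf_eq0 pnatr_eq0 /= intr_eq0 => /eqP.
Qed.

Lemma sS2 : (sS * sS)%g = sN.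
Proof.
have [a1 b1 c1 d1] := entry_mul sS sS; have [a2 b2 c2 d2] := sS_entry.
have [a3 b3 c3 d3] := sN_entry.
by apply: SL2Z_eqP; rewrite ?(a1, b1, c1, d1) ?(a2, b2, c2, d2) ?(a3, b3, c3, d3).
Qed.

Lemma Phi_sS : Phi sS = 0.
Proof.
have := Phi_cocycle sS sS; rewrite sS2 Phi_sN; have [_ _ -> _] := sN_entry.
by rewrite mulr0 sgz0; lia.
Qed.

Lemma Phi_sNl g : Phi (sN * g)%g = Phi g.
Proof. by rewrite Phi_cocycle Phi_sN; have [_ _ -> _] := sN_entry; rewrite !mul0r sgz0; lia. Qed.

Lemma Phi_sSl g : Phi (sS * g)%g = Phi g - 3 * sgz (entry_c g * entry_a g).
Proof.
rewrite Phi_cocycle Phi_sS add0r; have [_ _ -> _] := entry_mul sS g.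
by have [_ _ -> ->] := sS_entry; rewrite mul0r addr0 !mul1r.
Qed.

Lemma Phi_sSr g : Phi (g * sS)%g = Phi g - 3 * sgz (entry_c g * entry_d g).
Proof.
rewrite Phi_cocycle Phi_sS addr0; have [_ _ -> _] := entry_mul g sS.
by have [-> _ -> _] := sS_entry; rewrite mulr0 add0r !mulr1.
Qed.

Definition rad g := Phi g - 3 * sgz (entry_c g * (entry_a g + entry_d g)).

Lemma trE2 g : \tr (SL2Z_mx g) = entry_a g + entry_d g. Proof. exact: mxtrace22. Qed.

Lemma rad_sN g : rad (sN * g)%g = rad g.
Proof.
rewrite /rad Phi_sNl; have [-> _ -> ->] := entry_mul sN g; have [-> -> -> ->] := sN_entry.
by congr (_ - 3 * sgz _); ring.
Qed.

Lemma rad_conj_sR n g k : (k * sR n)%g = (sR n * g)%g -> rad k = rad g.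
Proof.
move=> E; have := congr1 Phi E; rewrite Phi_sRr Phi_sRl => e.
have [a1 b1 c1 d1] := entry_mul k (sR n); have [a2 b2 c2 d2] := entry_mul (sR n) g.
have [ea eb ec ed] := sR_entry n.
rewrite ea eb ec ed E in a1 b1 c1 d1; rewrite ea eb ec ed in a2 b2 c2 d2.
have c : entry_c k = entry_c g by lia.
have t : entry_a k + entry_d k = entry_a g + entry_d g by rewrite c2 in c1; nia.
by rewrite /rad c t; lia.
Qed.

(** The two sides agree if sgn a = sgn(a + d) or sgn b = - sgn c. The latter holds if bc < 0; if bc
    > 0, then ad > 1 and the former holds; bc = 0 would give trace 2 or -2. *)
Lemma rad_conj_sS g k : hyperbolic g -> (k * sS)%g = (sS * g)%g -> rad k = rad g.
Proof.
rewrite /hyperbolic trE2 => hg E; have := congr1 Phi E; rewrite Phi_sSr Phi_sSl => e.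
have [a1 b1 c1 d1] := entry_mul k sS; have [a2 b2 c2 d2] := entry_mul sS g.
have [ea eb ec ed] := sS_entry.
rewrite ea eb ec ed E in a1 b1 c1 d1; rewrite ea eb ec ed in a2 b2 c2 d2.
have := entry_det g; rewrite /rad.
have ka : entry_a k = entry_d g by lia.
have kd : entry_d k = entry_a g by lia.
have kc : entry_c k = - entry_b g by lia.
rewrite ka kd kc in e *; move: e hg.
move: (entry_a g) (entry_b g) (entry_c g) (entry_d g) (Phi g) (Phi k) => a b c d p q e hg dd.
have key : sgz a = sgz (a + d) \/ sgz b = - sgz c.
  case: (ltrgtP (b * c) 0) => bc.
  - right; case: (sgzP b); case: (sgzP c) => // *; nia.
  - left; case: (sgzP a); case: (sgzP (a + d)) => // *; nia.
  - have /pm1_mul[] : a * d = 1 by lia.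
      by case=> u v; rewrite u v in hg.
    by case=> u v; rewrite u v in hg.
have -> : q = p - 3 * sgz (c * a) + 3 * sgz (- b * a) by lia.
rewrite (addrC d) !sgzM sgzN; case: key => ->; ring.
Qed.

(** Euclidean algorithm on the first column. As [P] is closed under products only, the inverse of
    [sS] is written as [sN] times [sS], with [sN] the square of [sS]. *)
Lemma SL2Z_gen (P : SL2Z -> Prop) : (forall n, P (sR n)) -> P sS ->
  (forall g h, P g -> P h -> P (g * h)%g) -> forall h, P h.
Proof.
move=> PR PS PM h; have PN : P sN by rewrite -sS2; apply: PM.
have NN : (sN * sN)%g = 1%g.
  have [a1 b1 c1 d1] := entry_mul sN sN; have [a2 b2 c2 d2] := sN_entry.
  have mx1 : SL2Z_mx 1%g = mx2 1 0 0 1 by rewrite -mx2_1.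
  by apply: SL2Z_eqP; rewrite ?(a1, b1, c1, d1) ?(a2, b2, c2, d2)
    /entry_a /entry_b /entry_c /entry_d mx1 !mx2E.
have [n] := ubnP (absz (entry_c h)); elim: n h => // n IH h; rewrite ltnS => hn.
case: (eqVneq (entry_c h) 0) => [c0|c0].
  have := entry_det h; rewrite c0 mulr0 subr0 => /pm1_mul[] [ea ed].
    have -> : h = sR (entry_b h) by have [*] := sR_entry (entry_b h); apply: SL2Z_eqP; congruence.
    exact: PR.
  have -> : h = (sN * sR (- entry_b h))%g; last exact: PM.
  have [a1 b1 c1 d1] := entry_mul sN (sR (- entry_b h)); have [a2 b2 c2 d2] := sN_entry.
  have [a3 b3 c3 d3] := sR_entry (- entry_b h).
  by apply: SL2Z_eqP; rewrite ?(a1, b1, c1, d1) ?(a2, b2, c2, d2) ?(a3, b3, c3, d3) ?c0 ?ea ?ed; ring.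
pose k := - (entry_a h %/ entry_c h)%Z; pose x := (sR k * h)%g.
have E : h = (sR (- k) * (sN * (sS * (sS * x))))%g.
  rewrite /x !mulgA -(mulgA _ sS sS) sS2 -(mulgA _ sN sN) NN mulg1 -sR_add addNr.
  have [a1 b1 c1 d1] := entry_mul (sR 0) h; have [a2 b2 c2 d2] := sR_entry 0.
  by apply: SL2Z_eqP; rewrite ?(a1, b1, c1, d1) ?(a2, b2, c2, d2); ring.
rewrite E; apply: (PM _ _ (PR _) (PM _ _ PN (PM _ _ PS _))); apply: IH.
have [_ _ -> _] := entry_mul sS x; have [_ _ -> ->] := sS_entry.
have [-> _ _ _] := entry_mul (sR k) h; have [-> -> _ _] := sR_entry k.
have := divz_eq (entry_a h) (entry_c h); have := modz_ge0 (entry_a h) c0.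
have := ltz_mod (entry_a h) c0; rewrite /k; lia.
Qed.

Lemma hyperbolic_conj g k h : (k * h)%g = (h * g)%g -> hyperbolic g -> hyperbolic k.
Proof.
move=> E; rewrite /hyperbolic; suff -> : \tr (SL2Z_mx k) = \tr (SL2Z_mx g) by [].
have E' : SL2Z_mx k *m SL2Z_mx h = SL2Z_mx h *m SL2Z_mx g := congr1 SL2Z_mx E.
rewrite -[SL2Z_mx k](mulmxK (SL2Z_unit h)) E' mxtrace_mulC mulmxA mulVmx ?SL2Z_unit //.
by rewrite mul1mx.
Qed.

Lemma rad_conj h g k : hyperbolic g -> (k * h)%g = (h * g)%g -> rad k = rad g.
Proof.
move: h g k; apply: (@SL2Z_gen (fun h => forall g k, hyperbolic g -> (k * h)%g = (h * g)%g -> rad k = rad g)).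
- by move=> n g k _; apply: rad_conj_sR.
- by move=> g k; apply: rad_conj_sS.
move=> h1 h2 H1 H2 g k hg E; pose g' := (h2 * g * h2^-1)%g.
have E2 : (g' * h2)%g = (h2 * g)%g by rewrite /g' -!mulgA mulVg mulg1.
rewrite -(H2 g g') //; apply: (H1 g' k); first exact: hyperbolic_conj E2 hg.
by apply: (@mulIg _ h2); rewrite -[RHS]mulgA E2 -mulgA E mulgA.
Qed.

Definition sL (b : nat) := toSL (gen_mx false b).

Lemma sL_mx b : SL2Z_mx (sL b) = gen_mx false b.
Proof. by rewrite val_toSL // /gen_mx det_mx2; ring. Qed.

Lemma sL_entry b : [/\ entry_a (sL b) = 1, entry_b (sL b) = 0, entry_c (sL b) = b%:Z & entry_d (sL b) = 1].
Proof. by rewrite /entry_a /entry_b /entry_c /entry_d sL_mx /gen_mx !mx2E. Qed.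

Lemma sL_add b c : sL (b + c) = (sL b * sL c)%g.
Proof. by apply: val_inj; rewrite /= !sL_mx gen_mxD. Qed.

Lemma Phi_sL1 : Phi (sL 1) = 2.
Proof.
have -> : sL 1 = (sR 1 * (sS * sR 1))%g.
  apply: val_inj; rewrite /= sL_mx sR_mx sS_mx /gen_mx !mul_mx2.
  by apply: eq_mx22; rewrite !mx2E.
by rewrite Phi_sRl Phi_sRr Phi_sS Phi_sR.
Qed.

(** All lower left entries that occur are positive, so each factor L contributes its own value 2
    minus the cocycle term 3. *)
Lemma Phi_sLl b g : 0 < entry_a g -> 0 < entry_c g -> Phi (sL b * g)%g = Phi g - b%:Z.
Proof.
move=> a0 c0; elim: b => [|b IH].
  have -> : (sL 0 * g)%g = g; last by rewrite subr0.
  have [a1 b1 c1 d1] := entry_mul (sL 0) g; have [a2 b2 c2 d2] := sL_entry 0.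
  by apply: SL2Z_eqP; rewrite ?(a1, b1, c1, d1) ?(a2, b2, c2, d2); ring.
rewrite -add1n sL_add -mulgA Phi_cocycle IH Phi_sL1.
have [_ _ -> _] := entry_mul (sL 1) (sL b * g)%g; have [-> _ -> _] := entry_mul (sL b) g.
have [-> -> -> ->] := sL_entry b; have [_ _ -> ->] := sL_entry 1.
rewrite !mul1r mul0r addr0 PoszD gtr0_sgz; first by lia.
have h : 0 < b%:Z * entry_a g + entry_c g by apply: ltr_wpDl => //; rewrite mulr_ge0 // ltW.
by rewrite mulr_gt0 // addr_gt0.
Qed.

Lemma Phi_sL b : (0 < b)%N -> Phi (sL b) = 3 - b%:Z.
Proof.
case: b => // b _; rewrite -addn1 sL_add Phi_sLl ?Phi_sL1; last first.
- by have [_ _ -> _] := sL_entry 1.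
- by have [-> _ _ _] := sL_entry 1.
by rewrite PoszD; lia.
Qed.

(** The 3 comes from the last power of L, which has no word to its right; in [rad] it cancels
    against the sign term, all entries being positive. *)
Lemma Phi_cont s : good s -> Phi (toSL (cont s)) = 3 + alt s.
Proof.
have [n] := ubnP (size s); elim: n s => // n IH [|a [|b s]] //.
rewrite ltnS => hn g; have [_ o /and3P[a0 b0 ps]] := and3P g.
have -> : toSL (cont [:: a, b & s]) = (sR a%:Z * (sL b * toSL (cont s)))%g.
  have os : ~~ odd (size s) by move: o; rewrite /= negbK.
  have dL : \det (gen_mx false b *m cont s) = 1 by rewrite det_mulmx det_gen_mx det_cont -signr_odd (negPf os).
  have -> : cont [:: a, b & s] = gen_mx true a *m (gen_mx false b *m cont s) by rewrite -!word_mx_even.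
  by rewrite !toSL_mul ?det_gen_mx // det_cont -signr_odd (negPf os).
rewrite Phi_sRl Phi_sR /=; case: (eqVneq s [::]) => [->|s0].
  have -> : toSL (cont [::]) = 1%g by apply: val_inj; apply: val_toSL; rewrite det1.
  by rewrite mulg1 Phi_sL //=; lia.
have gs : good s by rewrite /good s0 /pos; move: o; rewrite /= !negbK => ->.
have vs : SL2Z_mx (toSL (cont s)) = cont s by rewrite val_toSL // det_cont_good.
have /and4P[h1 _ h2 _] := gt0mx_cont gs.
rewrite Phi_sLl ?IH //; try by rewrite /entry_a /entry_c vs.
  lia.
by move: hn; rewrite /=; lia.
Qed.

Lemma rad_cont s : good s -> rad (toSL (cont s)) = alt s.
Proof.
move=> g; rewrite /rad Phi_cont //.
have vs : SL2Z_mx (toSL (cont s)) = cont s by rewrite val_toSL // det_cont_good.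
have /and4P[h1 _ h2 h3] := gt0mx_cont g.
by rewrite /entry_a /entry_c /entry_d vs gtr0_sgz ?mulr_gt0 ?addr_gt0 //; lia.
Qed.

End Symbol.

Theorem rademacher_facts (R : realType) (Psi : SL2Z -> int) : rademacher_symbol R Psi ->
  [/\ forall g h, hyperbolic g -> Psi (g ^ h)%g = Psi g,
      forall s, good s -> Psi (toSL (cont s)) = alt s &
      forall g, Psi (sN * g)%g = Psi g].
Proof.
case=> Phi HPhi HPsi; have PE g : Psi g = rad Phi g by rewrite HPsi.
split=> [g h hg|s gs|g]; rewrite !PE.
- by apply: (rad_conj HPhi (h := h^-1%g) hg); rewrite /conjg -!mulgA mulgV mulg1.
- exact: (rad_cont HPhi).
- exact: (rad_sN HPhi).
Qed.

(** * Counting conjugacy classes *)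

Section Classes.
Implicit Types (g h k : SL2Z) (s t : seq nat).

Lemma conj_classP g k : conj_class g = conj_class k <-> exists h, k = (g ^ h)%g.
Proof.
split=> [E|[h ->]].
  have : conj_class g k by rewrite E; exists 1%g => //; rewrite conjg1.
  by case=> h _ <-; exists h.
rewrite /conj_class; apply/seteqP; split=> x [y _ <-].
  by exists (h^-1 * y)%g => //; rewrite conjgM conjgK.
by exists (h * y)%g => //; rewrite conjgM.
Qed.

Definition word_elt (e : bool) s : SL2Z :=
  if e then (sN * toSL (cont s))%g else toSL (cont s).

Lemma sN_mx : SL2Z_mx sN = - 1%:M.
Proof.
by rewrite val_toSL ?det_mx2 // mx2_1; apply: eq_mx22; rewrite [RHS]mxE !mx2E.
Qed.

Lemma word_elt_mx e s : good s -> SL2Z_mx (word_elt e s) = (-1) ^+ e *: cont s.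
Proof.
move=> gs; have E : SL2Z_mx (toSL (cont s)) = cont s by rewrite val_toSL // det_cont_good.
case: e; last by rewrite expr0 scale1r.
rewrite /word_elt -[SL2Z_mx (_ * _)%g]/(SL2Z_mx sN *m SL2Z_mx (toSL (cont s))) E sN_mx.
by rewrite expr1 scaleN1r mulNmx mul1mx.
Qed.

Lemma tr_gt2 s : good s -> 2 < tr s.
Proof.
move=> g; apply: le_lt_trans (tr_gt g); have := good_size_ge2 g.
by case: (size s) => [|[|n]] //= _; rewrite lez_nat expnS leq_pmulr // expn_gt0.
Qed.

Lemma word_elt_tr e s : good s -> \tr (SL2Z_mx (word_elt e s)) = (-1) ^+ e * tr s.
Proof. by move=> gs; rewrite word_elt_mx // mxtraceZ. Qed.

Lemma word_elt_abs_tr e s : good s -> `|\tr (SL2Z_mx (word_elt e s))| = tr s.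
Proof.
move=> gs; rewrite word_elt_tr // normrM normr_sign mul1r gtr0_norm //.
exact: lt_trans (tr_gt2 gs).
Qed.

Lemma word_elt_hyperbolic e s : good s -> hyperbolic (word_elt e s).
Proof. by move=> gs; rewrite /hyperbolic word_elt_abs_tr // tr_gt2. Qed.

Lemma conj_mx g k h : k = (g ^ h)%g -> SL2Z_mx h *m SL2Z_mx k = SL2Z_mx g *m SL2Z_mx h.
Proof.
move=> ->; rewrite /conjg -[LHS]/(SL2Z_mx (h * (h^-1 * (g * h)))%g).
by rewrite mulgA mulgV mul1g.
Qed.

Lemma mx_conj g k (u : 'M[int]_2) : \det u = 1 -> u *m SL2Z_mx k = SL2Z_mx g *m u ->
  k = (g ^ toSL u)%g.
Proof.
move=> du E; apply: (@mulgI _ (toSL u)); rewrite /conjg mulgA mulgV mul1g.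
by apply: val_inj; rewrite /= val_toSL.
Qed.

Lemma conj_tr g h : \tr (SL2Z_mx (g ^ h)%g) = \tr (SL2Z_mx g).
Proof.
have E := conj_mx (erefl (g ^ h)%g).
rewrite -[SL2Z_mx g](mulmxK (SL2Z_unit h)) -E [RHS]mxtrace_mulC mulmxA mulVmx ?SL2Z_unit //.
by rewrite mul1mx.
Qed.

Lemma class_rep g : hyperbolic g ->
  exists e s, good s /\ conj_class g = conj_class (word_elt e s).
Proof.
rewrite /hyperbolic => hg.
have [e he] : exists e : bool, 2 < (-1) ^+ e * \tr (SL2Z_mx g).
  case: (ltrP 0 (\tr (SL2Z_mx g))) => h.
    by exists false; rewrite expr0 mul1r -(gtr0_norm h).
  by exists true; rewrite expr1 mulN1r -(ler0_norm h).
have [||s gs [u du E]] := @hyperbolic_cont ((-1) ^+ e *: SL2Z_mx g).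
- by rewrite detZ SL2Z_det mulr1 -exprM mulnC exprM sqrrN !expr1n.
- by rewrite mxtraceZ.
exists e, s; split=> //; apply/esym/conj_classP; exists (toSL u); apply: mx_conj => //.
rewrite word_elt_mx // -scalemxAl -E -scalemxAr scalerA.
by rewrite -signr_addb addbb expr0 scale1r.
Qed.

Lemma word_elt_conj e e' s s' : good s -> good s' ->
  conj_class (word_elt e s) = conj_class (word_elt e' s') ->
  e = e' /\ exists2 i, ~~ odd i && (i <= size s)%N & s' = rot i s.
Proof.
move=> gs gs' /conj_classP[h E].
have ee : e = e'.
  have := congr1 (fun k : SL2Z => \tr (SL2Z_mx k)) E; rewrite conj_tr !word_elt_tr //.
  have := tr_gt2 gs; have := tr_gt2 gs'; case: (e); case: (e') => //; rewrite ?expr1 ?expr0; lia.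
split=> //; apply: (@conj_cont s' s (SL2Z_mx h)); rewrite ?SL2Z_det //.
have := conj_mx E; rewrite !word_elt_mx // ee -scalemxAr -scalemxAl.
move/(congr1 (fun A => (-1) ^+ e' *: A)); rewrite !scalerA -signr_addb addbb.
by rewrite !scale1r.
Qed.

Lemma word_elt_rot e s i : good s -> ~~ odd i -> (i <= size s)%N ->
  conj_class (word_elt e (rot i s)) = conj_class (word_elt e s).
Proof.
move=> gs oi hi; apply/esym/conj_classP; have [du E] := cont_rot_conj oi hi.
exists (toSL (cont (take i s))); apply: mx_conj => //.
by rewrite !word_elt_mx ?good_rot // -scalemxAl -scalemxAr E.
Qed.

Lemma SL2Z_mx_exp g n : SL2Z_mx (g ^+ n)%g = SL2Z_mx g ^+ n.
Proof.
elim: n => [|n IH]; first by rewrite expg0.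
by rewrite expgS expS_mul -IH.
Qed.

Lemma word_elt_primitive e s : good s -> ~~ periodic s -> primitive (word_elt e s).
Proof.
move=> gs ap h n n1 E; suff n1' : n = 1%N by rewrite n1' in n1.
apply: (@root_cont s (SL2Z_mx h) n e) => //; first exact: SL2Z_det.
  exact: ltnW.
by rewrite -SL2Z_mx_exp -E word_elt_mx.
Qed.

Lemma natr_count (F : pzSemiRingType) (T : Type) (a : pred T) (r : seq T) :
  \sum_(x <- r | a x) 1 = (count a r)%:R :> F.
Proof. by rewrite -sum1_count natr_sum. Qed.

(** Each value of [f] receives total weight 1 from its fibre. *)
Lemma size_undup_map (F : numFieldType) (T U : eqType) (A : seq T) (f : T -> U) :
  (size (undup (map f A)))%:R = \sum_(x <- A) (count (fun y => f y == f x) A)%:R^-1 :> F.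
Proof.
transitivity (\sum_(y <- undup (map f A)) \sum_(x <- A | f x == y)
    (count (fun z => f z == f x) A)%:R^-1 : F); last first.
  rewrite (exchange_big_dep xpredT) //= big_seq [RHS]big_seq; apply: eq_bigr => x xA.
  rewrite (eq_bigr (fun=> (count (fun z => f z == f x) A)%:R^-1 * 1)) => [|? _]; last by rewrite mulr1.
  rewrite -big_distrr /= natr_count (eq_count (a2 := pred1 (f x))) => [|y]; last by rewrite /= eq_sym.
  by rewrite count_uniq_mem ?undup_uniq // mem_undup map_f // mulr1.
rewrite -sum1_size natr_sum big_seq [RHS]big_seq; apply: eq_bigr => y.
rewrite mem_undup => /mapP[x xA ->].
rewrite (eq_bigr (fun=> (count (fun z => f z == f x) A)%:R^-1 * 1)) => [|z /eqP->]; last by rewrite mulr1.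
rewrite -big_distrr /= natr_count.
rewrite mulVf // pnatr_eq0 -lt0n -has_count; apply/hasP; by exists x.
Qed.

Lemma alt_rot_even s i : good s -> ~~ odd i -> (i <= size s)%N -> alt (rot i s) = alt s.
Proof.
move=> gs oi hi; have [_ os _] := and3P gs.
rewrite -{2}(cat_take_drop i s) /rot !alt_cat size_drop size_takel //.
rewrite -signr_odd -[in RHS]signr_odd oddB // (negPf oi) (negPf os) /= !expr0 !mul1r; ring.
Qed.

Lemma periodic_rot i s : periodic (rot i s) = periodic s.
Proof.
apply/periodicP/periodicP => -[j hj E]; exists j; rewrite ?size_rot // in hj *.
  by apply: (@rot_inj i); rewrite rot_rot.
by rewrite rot_rot E.
Qed.

Section Count.
Variable F : realFieldType.
Variable P : pred (seq nat).
Hypothesis Prot : forall s i, good s -> ~~ odd i -> (i <= size s)%N -> P (rot i s) = P s.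

Definition classes_of (A : seq (seq nat)) :=
  undup [seq conj_class (word_elt p.1 p.2) | p <- [seq (e, s) | e <- [:: true; false], s <- A]].

(** The trace determines the sign, and the fibre consists of the even rotations of [s], which are
    distinct because [s] is aperiodic. *)
Lemma count_fibre V e s : let A := [seq s <- words V | P s && ~~ periodic s] in s \in A ->
  count (fun q => conj_class (word_elt q.1 q.2) == conj_class (word_elt e s))
    [seq (e, s) | e <- [:: true; false], s <- A] = (size s)./2.
Proof.
move=> A sA; have := sA; rewrite mem_filter => /andP[/andP[Ps aps] sW].
have [gs ts] : good s /\ tr s < V%:Z by apply/andP; rewrite -mem_words.
have [_ os _] := and3P gs.
rewrite -size_filter -[RHS](size_iota 0) -[RHS](size_map (fun i => (e, rot i.*2 s))).
apply: perm_size; apply: uniq_perm.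
- rewrite filter_uniq //; apply: allpairs_uniq => //; first by rewrite filter_uniq // uniq_words.
  by move=> [e1 s1] [e2 s2] _ _ /= [-> ->].
- rewrite map_inj_in_uniq ?iota_uniq //.
  have main i j : (i < j)%N -> (j < (size s)./2)%N -> rot i.*2 s = rot j.*2 s -> False.
    move=> ij js E; case/negP: aps; apply/periodicP; exists (j - i).*2.
      by rewrite odd_double; lia.
    apply: (@rot_inj i.*2); rewrite rot_rot -rotD; last by lia.
    by rewrite -doubleD subnK ?(ltnW ij) // E.
  move=> i j; rewrite !mem_iota !add0n => /andP[_ hi] /andP[_ hj] [E].
  by case: (ltngtP i j) => // h; [case: (main i j h hj E)|case: (main j i h hi (esym E))].
move=> [e' t]; rewrite mem_filter; apply/andP/mapP => [H|H].
  case: H => E0 /allpairsP H; have /= E := eqP E0; case: H => [[e1 t1] /= [_ tA [e1E t1E]]]; subst e1 t1.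
  have gt : good t by move: tA; rewrite mem_filter mem_words => /and3P[].
  have [ee [i /andP[oi hi] ->]] := word_elt_conj gs gt (esym E).
  case: (ltnP i (size s)) => his; last first.
    exists 0%N; last by rewrite ee double0 rot0 rot_oversize.
    by rewrite mem_iota /= add0n half_gt0 good_size_ge2.
  exists i./2; last by rewrite even_halfK ?ee.
  by rewrite mem_iota add0n -ltn_double !even_halfK.
case: H => i; rewrite mem_iota add0n => /andP[_ hi] [-> ->].
have h2 : (i.*2 <= size s)%N by lia.
split; first by rewrite word_elt_rot // odd_double.
apply/allpairsP; exists (e, rot i.*2 s); split=> //=; first by case: (e).
by rewrite mem_filter rot_words periodic_rot Prot ?odd_double // Ps aps sW.
Qed.

Lemma size_classes_of V :
  (size (classes_of [seq s <- words V | P s && ~~ periodic s]))%:R =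
  4 * \sum_(s <- words V | P s && ~~ periodic s) (size s)%:R^-1 :> F.
Proof.
rewrite size_undup_map big_allpairs -[in RHS]big_filter; set A := [seq s <- words V | _].
have half e : \sum_(s <- A) (count (fun y => conj_class (word_elt y.1 y.2) == conj_class (word_elt e s))
    [seq (i1, i2) | i1 <- [:: true; false], i2 <- A])%:R^-1 = 2 * \sum_(s <- A) (size s)%:R^-1 :> F.
  rewrite big_distrr /= !big_seq; apply: eq_bigr => s sA; rewrite count_fibre //.
  have [gs _] : good s /\ tr s < V%:Z.
    by apply/andP; rewrite -mem_words; move: sA; rewrite mem_filter => /andP[].
  have [_ os _] := and3P gs.
  rewrite -{2}(even_halfK os) -muln2 natrM invfM mulrCA divff ?mulr1 // pnatr_eq0.
rewrite (eq_bigr (fun=> 2 * \sum_(s <- A) (size s)%:R^-1)) => [|e _]; last exact: half e.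
by move: (\sum_(s <- A) _) => x; rewrite !big_cons big_nil /=; ring.
Qed.

(** Periodic words are left undecided, since with the sign -1 they may give primitive elements
    (minus a square, for instance). They account for the gap, with two signs for each word. *)
Lemma num_classes_bounds V (X : set SL2Z) :
  (forall g, X g -> exists e s, [/\ s \in words V, P s & conj_class g = conj_class (word_elt e s)]) ->
  (forall e s, s \in words V -> P s -> ~~ periodic s -> X (word_elt e s)) ->
  let M : F := 4 * \sum_(s <- words V | P s && ~~ periodic s) (size s)%:R^-1 in
  M <= (num_classes X)%:R /\
  (num_classes X)%:R <= M + 2 * \sum_(s <- words V | periodic s) 1.
Proof.
move=> H1 H2; set A := [seq s <- words V | P s && ~~ periodic s].
pose B := [seq s <- words V | periodic s].
pose LB := [seq conj_class (word_elt p.1 p.2) | p <- [seq (e, s) | e <- [:: true; false], s <- B]].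
have sub x : (conj_class @` X) x -> x \in classes_of A ++ LB.
  case=> g /H1[e [s [sW Ps ->]]] <-; rewrite mem_cat mem_undup.
  have ine : e \in [:: true; false] by case: (e).
  case: (boolP (periodic s)) => ps; apply/orP; [right|left].
    apply/mapP; exists (e, s) => //; apply/allpairsP; exists (e, s); split=> //=.
    by rewrite mem_filter ps.
  apply/mapP; exists (e, s) => //; apply/allpairsP; exists (e, s); split=> //=.
  by rewrite mem_filter ps Ps.
(* Finiteness excludes the default value 0 in [num_classes]. *)
have fin : finite_set (conj_class @` X).
  by apply: sub_finite_set (finite_seq (classes_of A ++ LB)) => x /sub.
have up : (num_classes X <= size (classes_of A) + size LB)%N.
  rewrite -size_cat; apply: uniq_leq_size; first exact: fset_uniq.
  by move=> x; rewrite in_fset_set // inE => /sub.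
have low : (size (classes_of A) <= num_classes X)%N.
  apply: uniq_leq_size; first exact: undup_uniq.
  move=> x; rewrite mem_undup in_fset_set // => /mapP[[e s] /allpairsP[[e' s'] /= [_ sA [-> ->]]] ->].
  rewrite inE; exists (word_elt e' s') => //.
  by move: sA; rewrite mem_filter => /andP[/andP[Ps ps] sW]; apply: H2.
have sB : (size LB)%:R = 2 * \sum_(s <- words V | periodic s) 1 :> F.
  rewrite size_map size_allpairs natrM /=; congr (_ * _).
  by rewrite -sum1_size natr_sum big_filter.
by rewrite /= -size_classes_of -/A -sB -natrD !ler_nat.
Qed.

End Count.

End Classes.

(** Rotation by one letter exchanges the residues [k] and [- k], so each carries half of the
    symmetrized sum. *)
Lemma sum_residue (F : realFieldType) (m : nat) (k : int) V :
  \sum_(s <- words V | (m %| alt s - k)%Z) (size s)%:R^-1 =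
  (disc_sum F m k V + 2 * m%:R^-1 * weight F V) / 2.
Proof.
set A := \sum_(s <- words V | _) _.
have E1 : \sum_(s <- words V) ind F m k (alt s) / (size s)%:R = A.
  rewrite /A [RHS]big_mkcond; apply: eq_bigr => s _; rewrite /ind.
  by case: (_ %| _)%Z; rewrite ?mul1r ?mul0r.
have E2 : \sum_(s <- words V) ind F m (- k) (alt s) / (size s)%:R = A.
  rewrite -E1 -[RHS](sum_rot V 1) big_seq [RHS]big_seq; apply: eq_bigr => s.
  by rewrite mem_words => /andP[gs _]; rewrite size_rot alt_rot1 // indN.
have -> : disc_sum F m k V = A + A - 2 * m%:R^-1 * weight F V.
  rewrite -{1}E1 -E2 /weight big_distrr /= -big_split -sumrB; apply: eq_bigr => s _.
  by rewrite /disc /=; ring.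
by rewrite subrK; field.
Qed.

Lemma num_classes_approx (F : realFieldType) (P : pred (seq nat)) V (X : set SL2Z) :
  (forall s i, good s -> ~~ odd i -> (i <= size s)%N -> P (rot i s) = P s) ->
  (forall g, X g -> exists e s, [/\ s \in words V, P s & conj_class g = conj_class (word_elt e s)]) ->
  (forall e s, s \in words V -> P s -> ~~ periodic s -> X (word_elt e s)) ->
  `|(num_classes X)%:R - 4 * \sum_(s <- words V | P s) (size s)%:R^-1| <=
    4 * \sum_(s <- words V | periodic s) 1 :> F.
Proof.
move=> Prot H1 H2; have [] := num_classes_bounds F Prot H1 H2.
rewrite [\sum_(s <- words V | P s) _](bigID periodic) /=.
have h0 : 0 <= \sum_(s <- words V | P s && periodic s) (size s)%:R^-1 :> F.
  by apply: sumr_ge0 => s _; rewrite invr_ge0.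
have h1 : \sum_(s <- words V | P s && periodic s) (size s)%:R^-1 <= \sum_(s <- words V | periodic s) 1 :> F.
  rewrite big_mkcond [leRHS]big_mkcond !big_seq; apply: ler_sum => s.
  rewrite mem_words => /andP[/good_size_ge2 s2 _]; case: (P s); case: (periodic s) => //=.
  by rewrite invf_le1 ?ler1n ?ltr0n; case: (size s) s2.
by rewrite ler_norml; move=> *; apply/andP; split; lra.
Qed.

(** The numerator of the difference is at most 8N + 2|D|, hence at most 10t / E, while the
    denominator [d] is at least 2t. *)
Lemma ratio_bound (F : realFieldType) (E n d t D N u : F) :
  2 <= E -> 0 < t -> 0 <= u <= 1 -> E * `|D| <= t -> E * N <= t ->
  `|n - 4 * ((D + 2 * u * t) / 2)| <= 4 * N -> `|d - 4 * t| <= 4 * N ->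
  `|u - n / d| <= 5 / E.
Proof.
move=> E2 t0 /andP[u0 u1] hD hN hn hd.
have E0 : 0 < E by lra.
have N0 : 0 <= N by have := normr_ge0 (d - 4 * t); lra.
have D0 := normr_ge0 D.
have d2 : 2 * t <= d.
  have : 2 * N <= E * N by rewrite ler_wpM2r.
  by move: hd; rewrite ler_norml => /andP[h _]; lra.
have d0 : 0 < d by lra.
have -> : u - n / d = (u * d - n) / d by field; rewrite gt_eqF.
rewrite normrM normfV (gtr0_norm d0) ler_pdivrMr // mulrAC ler_pdivlMr //.
have k1 : `|u * d - n| <= 8 * N + 2 * `|D|.
  have -> : u * d - n = u * (d - 4 * t) - (n - 4 * ((D + 2 * u * t) / 2)) - 2 * D by field.
  apply: le_trans (ler_normB _ _) _; rewrite normrM (ger0_norm (ler0n _ 2)); apply: lerD => //.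
  apply: le_trans (ler_normB _ _) _; rewrite normrM (ger0_norm u0).
  have : u * `|d - 4 * t| <= 1 * (4 * N) by apply: ler_pM.
  by lra.
have k2 : `|u * d - n| * E <= (8 * N + 2 * `|D|) * E by rewrite ler_wpM2r // ltW.
by lra.
Qed.

Theorem corollary6p1 (R : realType) (Psi : SL2Z -> int)
    (HPsi : rademacher_symbol R Psi) (m : nat) (m_gt0 : (0 < m)%N) (k : int) :
  (fun nu : R =>
     (num_classes [set g : SL2Z | [/\ primitive g, hyperbolic g,
        (`|\tr g|)%:~R < nu & (Psi g = k %[mod m])%Z]])%:R
   / (num_classes [set g : SL2Z | [/\ primitive g, hyperbolic g &
        (`|\tr g|)%:~R < nu]])%:R : R) @ +oo --> (m%:R^-1 : R).
Proof.
have [PsiJ Psi_word PsiN] := rademacher_facts HPsi.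
have Psi_elt e s : good s -> Psi (word_elt e s) = alt s.
  by move=> gs; case: e; rewrite /word_elt ?PsiN Psi_word.
have Psi_class g h : hyperbolic h -> conj_class g = conj_class h -> Psi g = Psi h.
  by move=> hh /esym/conj_classP[y ->]; apply: PsiJ.
have tr_class g h : conj_class g = conj_class h -> \tr (SL2Z_mx g) = \tr (SL2Z_mx h).
  by move=> /conj_classP[y ->]; rewrite conj_tr.
(* Traces are integers, so the real bound can be replaced by its ceiling, which indexes [words]. *)
have trV (nu : R) (x : int) : 0 < nu -> (x%:~R < nu) = (x < (absz (Num.ceil nu))%:Z).
  by move=> nu0; rewrite gez0_abs ?ceil_ge0 1?ceil_gt_int //; lra.
have rep (nu : R) g : 0 < nu -> hyperbolic g -> (`|\tr g|)%:~R < nu ->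
    exists e s, [/\ s \in words (absz (Num.ceil nu)), good s, Psi g = alt s & conj_class g = conj_class (word_elt e s)].
  move=> nu0 hg tg; have [e [s [gs E]]] := class_rep hg; exists e, s; split=> //.
    by rewrite mem_words gs -(@word_elt_abs_tr e s gs) -(tr_class _ _ E) -trV.
  by rewrite -(Psi_elt e s gs); apply: Psi_class => //; apply: word_elt_hyperbolic.
apply/cvgrPdist_le => /= eps eps0.
pose E := (absz (Num.ceil (5 / eps))).+2.
have E2 : 2 <= E%:R :> R by rewrite ler_nat.
have EE : 5 / E%:R <= eps.
  rewrite ler_pdivrMr ?ltr0n // mulrC -ler_pdivrMr //.
  apply: le_trans (ceil_ge _) _; rewrite -[E%:R]/(E%:Z%:~R) ler_int /E; move: (Num.ceil _) => c; lia.
have [V1 H1] := disc_sum_small R k E m_gt0.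
have [V2 H2] := periodic_small R E.
exists ((maxn (maxn V1 V2) 4)%:R : R); split; first exact: num_real.
move=> nu hnu; set V := absz (Num.ceil nu).
have nu0 : 0 < nu by apply: lt_trans hnu; rewrite ltr0n; lia.
have hV : (maxn (maxn V1 V2) 4 <= V)%N.
  by move: hnu; rewrite -[_%:R]/((_ : nat)%:Z%:~R) trV //; lia.
apply: le_trans EE; apply: (@ratio_bound _ E%:R _ _ (weight R V) (disc_sum R m k V) (\sum_(s <- words V | periodic s) 1)).
- exact: E2.
- by apply: lt_le_trans (weight_ge_half _ _); rewrite ?invr_gt0 //; lia.
- by rewrite invr_ge0 ler0n /= invf_le1 ?ltr0n // ler1n.
- by apply: H1; lia.
- by apply: H2; lia.
- rewrite -sum_residue; apply: num_classes_approx.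
  + by move=> s i gs oi hi; rewrite alt_rot_even.
  + move=> g [_ hg tg kg]; have [e [s [sW gs Ps Es]]] := rep nu g nu0 hg tg.
    by exists e, s; split=> //; rewrite -Ps -eqz_mod_dvd; apply/eqP.
  + move=> e s; rewrite mem_words => /andP[gs ts] Ps ap; split.
    * exact: word_elt_primitive.
    * exact: word_elt_hyperbolic.
    * by rewrite word_elt_abs_tr // trV.
    * by rewrite Psi_elt //; apply/eqP; rewrite eqz_mod_dvd.
rewrite /weight; apply: (@num_classes_approx _ xpredT) => //.
- by move=> g [_ hg tg]; have [e [s [sW gs Ps Es]]] := rep nu g nu0 hg tg; exists e, s.
- move=> e s; rewrite mem_words => /andP[gs ts] _ ap; split.
  + exact: word_elt_primitive.
  + exact: word_elt_hyperbolic.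
  + by rewrite word_elt_abs_tr // trV.
Qed.
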